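(* Let $G$ be a finite group acting smoothly on a manifold $M$, with quotient map $\pi\colon M\to M/G$, and let $I=[0,1]$. 1. For every exit path $f$ in $M/G$ there is an immediately exiting path $f'$ in $M/G$ that is exit path homotopic (rel endpoints) to $f$. 2. Every exit path homotopy $\mathcal{H}\colon I\times I\to M/G$ is homotopic to an immediately exiting homotopy $\tilde{\mathcal{H}}$ in $M/G$: there is a continuous map $\Phi\colon I\times I\times I\to M/G$ with $\Phi(\cdot,\cdot,0)=\mathcal{H}$ and $\Phi(\cdot,\cdot,1)=\tilde{\mathcal{H}}$, with $\tilde{\mathcal H}$ an immediately exiting homotopy, such that for all $s,\alpha\in I$ the path $\Phi(\cdot,s,\alpha)$ is an exit path with the same endpoints as $\mathcal{H}(\cdot,s)$. 3. Immediately exiting homotopies lift: for every immediately exiting homotopy $\mathcal{K}\colon I\times I\to M/G$ and every $y\in M$ with $\pi(y)=\mathcal{K}(1,0)$, there is a continuous map $\tilde{\mathcal{K}}\colon I\times I\to M$ with $\pi\circ\tilde{\mathcal{K}}=\mathcal{K}$ and $\tilde{\mathcal K}(1,0)=y$. Moreover, in (1) the immediately exiting path $f'$ and an exit path homotopy $\mathcal{F}\colon I\times I\to M/G$ from $f$ to $f'$ can be taken such that $\mathcal{F}$ lifts: for every $y\in M$ with $\pi(y)=f(1)$ there is a continuous $\tilde{\mathcal{F}}\colon I\times I\to M$ with $\pi\circ\tilde{\mathcal{F}}=\mathcal{F}$ and $\tilde{\mathcal F}(1,0)=y$.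
   Context: A poset $P$ carries the Alexandrov topology (open sets = upward closed sets). A stratification of a space $X$ is a continuous map $\mathcal{S}\colon X\to P$ to a poset. An exit path is a continuous $f\colon I\to X$ with $\mathcal{S}(f(s))\le\mathcal{S}(f(t))$ whenever $s\le t$. An exit path homotopy between exit paths $f,g$ is a homotopy $\mathcal{H}\colon I\times I\to X$, $(t,s)\mapsto\mathcal{H}(t,s)$, rel endpoints, with $\mathcal{H}(\cdot,0)=f$, $\mathcal{H}(\cdot,1)=g$, such that each $\mathcal{H}|_{I\times\{s\}}$ is an exit path. An immediately exiting path is an exit path $f$ which takes image in exactly two strata: there are $p<q$ in $P$ with $\mathcal{S}(f(0))=p$ and $\mathcal{S}(f(t))=q$ for all $t\in(0,1]$. An immediately exiting homotopy is an exit path homotopy (rel endpoints) $\mathcal{H}$ such that every $\mathcal{H}|_{I\times\{s\}}$ is an immediately exiting path. For a finite group $G$, $P_G$ is the poset of conjugacy classes of subgroups of $G$, with $[H]\le[K]$ iff $H$ is conjugate to a subgroup of $K$. $M$ is stratified by $x\mapsto[G_x]\in P_G^{\mathrm{op}}$ ($G_x$ the stabilizer), and $M/G$ (quotient topology) is stratified by $[x]\mapsto[G_x]\in P_G^{\mathrm{op}}$.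
   Formalization: Immediately exiting paths are allowed p ≤ q instead of p < q, since with p < q parts (1) and (2) fail for any path whose endpoints lie in one stratum (e.g. a constant path); when the endpoints lie in different strata, p < q still holds. *)

(* Defs.v *)
From HB Require Import structures.
From mathcomp Require Import all_boot all_order all_algebra all_fingroup.
From mathcomp Require Import all_classical all_reals all_analysis.
From mathcomp Require Import generic_quotient.
Import Order.TTheory GRing.Theory Num.Theory.
Import numFieldNormedType.Exports.
Set Implicit Arguments.
Unset Strict Implicit.
Unset Printing Implicit Defensive.
Local Open Scope classical_set_scope.
Local Open Scope ring_scope.
Local Open Scope quotient_scope.

(* [Ck k U f] : f is of class C^k on U, for U open. *)
Fixpoint Ck (R : realType) (m n k : nat) (U : set 'rV[R]_m)
    (f : 'rV[R]_m -> 'rV[R]_n) : Prop :=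
  if k is k'.+1 then
    (forall x, U x -> differentiable f x) /\ (forall v, Ck k' U ('D_v f))
  else forall x, U x -> {for x, continuous f}.

Definition smooth_on (R : realType) (m n : nat) (U : set 'rV[R]_m)
    (f : 'rV[R]_m -> 'rV[R]_n) : Prop :=
  forall k, Ck k U f.

(* The maps of a chart are total functions; their values outside [chart_dom],
   resp. outside its image, are irrelevant. *)
Record chart (R : realType) (n : nat) (X : topologicalType) := Chart {
  chart_dom : set X;
  chart_map : X -> 'rV[R]_n;
  chart_inv : 'rV[R]_n -> X;
  chart_dom_open : open chart_dom;
  chart_img_open : open (chart_map @` chart_dom);
  chart_mapK : {in chart_dom, cancel chart_map chart_inv};
  chart_map_continuous : {within chart_dom, continuous chart_map};
  chart_inv_continuous :
    {within chart_map @` chart_dom, continuous chart_inv} }.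

(* Smooth manifold without boundary, of dimension n (possibly 0). *)
Record manifold (R : realType) (n : nat) := Manifold {
  manifold_space :> topologicalType;
  manifold_hausdorff : hausdorff_space manifold_space;
  manifold_second_countable : @second_countable manifold_space;
  atlas : set (chart R n manifold_space);
  atlas_cover : forall x, exists2 c, atlas c & chart_dom c x;
  atlas_compatible : forall c d, atlas c -> atlas d ->
    smooth_on (chart_map c @` (chart_dom c `&` chart_dom d))
              (chart_map d \o chart_inv c) }.

Definition smooth_map (R : realType) (m n : nat)
    (M : manifold R m) (N : manifold R n) (F : M -> N) : Prop :=
  continuous F /\
  forall c d, atlas c -> atlas d ->
    smooth_on (chart_map c @` (chart_dom c `&` F @^-1` chart_dom d))
              (chart_map d \o F \o chart_inv c).

(* A left action; the library's theory of group actions is about right actions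
   on finite types. *)
Record smooth_action (R : realType) (n : nat) (M : manifold R n)
    (gT : finGroupType) := SmoothAction {
  smact :> gT -> M -> M;
  smact1 : forall x, smact 1%g x = x;
  smactM : forall g h x, smact (g * h)%g x = smact g (smact h x);
  smact_smooth : forall g, smooth_map (smact g) }.

Section ConjugacyClasses.
Variable gT : finGroupType.
Implicit Types H K : {group gT}.

Definition conj_rel : rel {group gT} :=
  fun H K => [exists g, H :^ g == K :> {set gT}]%g.

Lemma conj_rel_equiv : equiv_class_of conj_rel.
Proof.
split=> [H|H K|K H L].
- by apply/existsP; exists 1%g; rewrite conjsg1.
- apply/existsP/existsP => -[g /eqP e]; exists g^-1%g;
    by rewrite -e conjsgK.
- move=> /existsP[g /eqP e] /existsP[h /eqP e'].
  by apply/existsP; exists (g * h)%g; rewrite conjsgM e e'.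
Qed.

Canonical conj_rel_equivRel := EquivRelPack conj_rel_equiv.

Definition conj_classes := {eq_quot conj_rel}.
HB.instance Definition _ := EqQuotient.on conj_classes.
HB.instance Definition _ := Choice.on conj_classes.

Definition conj_class H : conj_classes := \pi H.

Definition subconj (C D : conj_classes) : bool :=
  [exists g, (repr C :^ g)%g \subset repr D].

Lemma subconj_refl : reflexive subconj.
Proof. by move=> C; apply/existsP; exists 1%g; rewrite conjsg1. Qed.

Lemma subconj_anti : antisymmetric subconj.
Proof.
move=> C D /andP[/existsP[g sg] /existsP[h sh]].
rewrite -[C]reprK -[D]reprK; apply/eqmodP; apply/existsP; exists g.
rewrite eqEcard sg cardJg.
by have := subset_leq_card sh; rewrite cardJg.
Qed.

Lemma subconj_trans : transitive subconj.
Proof.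
move=> D C E /existsP[g sg] /existsP[h sh]; apply/existsP; exists (g * h)%g.
by rewrite conjsgM (fintype.subset_trans _ sh)// conjSg.
Qed.

HB.instance Definition _ := Order.Le_isPOrder.Build (Order.Disp tt tt)
  conj_classes subconj_refl subconj_anti subconj_trans.

Lemma conj_class_le H K :
  (conj_class H <= conj_class K)%O = [exists g, (H :^ g)%g \subset K].
Proof.
have rep (L : {group gT}) : exists a, (repr (conj_class L) :^ a = L :> {set gT})%g.
  have /eqmodP/existsP[a /eqP e] : repr (conj_class L) = L %[mod conj_classes].
    by rewrite reprK.
  by exists a.
have [a eH] := rep H; have [b eK] := rep K.
apply/existsP/existsP => -[g sg].
- exists (a^-1 * g * b)%g; rewrite -[in X in X \subset _]eH -conjsgM.
  by rewrite !mulgA mulgV mul1g conjsgM -eK conjSg.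
- exists (a * g * b^-1)%g; rewrite !conjsgM eH.
  by rewrite sub_conjgV eK.
Qed.

End ConjugacyClasses.

Definition alexandrov (d : Order.disp_t) (P : porderType d) : Type := P.

Section Alexandrov.
Variables (d : Order.disp_t) (P : porderType d).

HB.instance Definition _ := Order.POrder.on (alexandrov P).

Definition up_closed (U : set (alexandrov P)) : Prop :=
  forall p q, U p -> (p <= q)%O -> U q.

Lemma up_closedT : up_closed setT. Proof. by []. Qed.

Lemma up_closedI : setI_closed up_closed.
Proof.
move=> A B uA uB p q [Ap Bp] pq; split; [exact: uA Ap pq|exact: uB Bp pq].
Qed.

Lemma up_closed_bigcup (I : Type) (f : I -> set (alexandrov P)) :
  (forall i, up_closed (f i)) -> up_closed (\bigcup_i f i).
Proof. by move=> uf p q [i _ fp] pq; exists i => //; exact: uf fp pq. Qed.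

HB.instance Definition _ := isOpenTopological.Build (alexandrov P)
  up_closedT up_closedI up_closed_bigcup.

End Alexandrov.

Record stratification (X : topologicalType) (d : Order.disp_t)
    (P : porderType d) := Stratification {
  strat :> X -> P;
  strat_continuous : continuous (strat : X -> alexandrov P) }.

Section OrbitSpace.
Variables (R : realType) (n : nat) (M : manifold R n) (gT : finGroupType).
Variable act : smooth_action M gT.

Lemma smactK g : cancel (act g) (act g^-1%g).
Proof. by move=> x; rewrite -smactM mulVg smact1. Qed.

Definition orbit_rel : rel M := fun x y => [exists g, act g x == y].

Lemma orbit_rel_equiv : equiv_class_of orbit_rel.
Proof.
split=> [x|x y|y x z].
- by apply/existsP; exists 1%g; rewrite smact1.
- by apply/existsP/existsP => -[g /eqP <-]; exists g^-1%g; rewrite smactK.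
- move=> /existsP[g /eqP <-] /existsP[h /eqP <-].
  by apply/existsP; exists (h * g)%g; rewrite smactM.
Qed.

Canonical orbit_rel_equivRel := EquivRelPack orbit_rel_equiv.

Definition orbit_space : Type := quotient_topology {eq_quot orbit_rel}.
HB.instance Definition _ := Topological.on orbit_space.
HB.instance Definition _ := Quotient.on orbit_space.

Definition orbit_pi (x : M) : orbit_space := \pi x.

Definition stab (x : M) : {set gT} := [set g | act g x == x]%SET.

Lemma stab_group_set x : group_set (stab x).
Proof.
apply/group_setP; split=> [|g h]; rewrite !inE ?smact1// => /eqP eg /eqP eh.
by rewrite smactM eh eg.
Qed.

Canonical stab_group x := Group (stab_group_set x).

Definition stab_type (x : M) : (conj_classes gT)^d := conj_class (stab_group x).

Lemma stab_typeJ x g : stab_type (act g x) = stab_type x.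
Proof.
apply/eqmodP/existsP; exists g; apply/eqP/setP => h.
rewrite mem_conjg !inE conjgE invgK !smactM smactK.
by rewrite (can_eq (smactK g)).
Qed.

Lemma stab_type_near (x : M) : \forall y \near x, stab y \subset stab x.
Proof.
have near_g (g : gT) : \forall y \near x, g \in stab y -> g \in stab x.
  have [gx|gx] := boolP (g \in stab x); first by near=> y.
  have neq : act g x != x by move: gx; rewrite inE.
  have := @manifold_hausdorff _ _ M; rewrite open_hausdorff.
  move=> /(_ _ _ neq)[[A B] /= [xA xB] [oA oB /eqP AB]].
  have cg : {for x, continuous (act g)}.
    by have [+ _] := smact_smooth act g; exact.
  have nA : nbhs (act g x) A by apply: open_nbhs_nbhs; split => //; rewrite inE in xA.
  have nB : nbhs x B by apply: open_nbhs_nbhs; split => //; rewrite inE in xB.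
  near=> y; rewrite inE => /eqP yg; exfalso.
  have : (A `&` B) y.
    split; last by near: y.
    by rewrite -yg; near: y; exact: cg nA.
  by rewrite AB.
have : \forall y \near x, forall g, g \in stab y -> g \in stab x.
  exact: filter_forall.
by apply: filterS => y h; apply/fintype.subsetP.
Unshelve. all: by end_near.
Qed.

Lemma orbit_piP (x y : M) : orbit_pi x = orbit_pi y <-> exists g, act g x = y.
Proof.
rewrite /orbit_pi; split=> [xy|[g e]].
  by have /eqmodP/existsP[g /eqP] := xy; exists g.
by apply/eqmodP/existsP; exists g; rewrite e.
Qed.

Lemma stab_type_repr x : stab_type (repr (orbit_pi x)) = stab_type x.
Proof.
have /orbit_piP[g e] : orbit_pi (repr (orbit_pi x)) = orbit_pi x.
  exact: reprK (orbit_pi x).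
by rewrite -(stab_typeJ _ g) e.
Qed.

Lemma orbit_strat_continuous :
  continuous ((fun q : orbit_space => stab_type (repr q)) :
    orbit_space -> alexandrov (conj_classes gT)^d).
Proof.
apply/continuousP => U uU.
rewrite {1}/open /= /quotient_open /= openE => x /= Ux.
rewrite -[\pi_ _ x]/(orbit_pi x) stab_type_repr in Ux.
rewrite /interior; apply: filterS (stab_type_near x) => y sy.
rewrite /= -[\pi_ _ y]/(orbit_pi y) stab_type_repr; apply: uU Ux _.
by rewrite leEdual conj_class_le; apply/existsP; exists 1%g; rewrite conjsg1.
Qed.

(* [repr q] is a chosen point of the orbit q. *)
Definition orbit_strat : stratification orbit_space (conj_classes gT)^d :=
  Stratification orbit_strat_continuous.

Lemma orbit_stratE x : orbit_strat (orbit_pi x) = stab_type x.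
Proof. exact: stab_type_repr. Qed.

End OrbitSpace.

Definition unitI (R : realType) : set R := `[0, 1]%classic.
Arguments unitI {R}.

(* Maps on I, I x I and I x I x I are represented by maps on R, R * R and
   R * R * R, whose values outside the unit interval, square and cube are
   irrelevant. In homotopies (t, s), t is the path parameter. *)
Section ExitPaths.
Variables (R : realType) (X : topologicalType) (d : Order.disp_t).
Variables (P : porderType d) (S : stratification X P).

Definition exit_path (f : R -> X) : Prop :=
  {within unitI, continuous f} /\
  forall s t, unitI s -> unitI t -> s <= t -> (S (f s) <= S (f t))%O.

Definition exit_path_homotopy_between (f g : R -> X) (H : R * R -> X) : Prop :=
  [/\ {within unitI `*` unitI, continuous H},
      forall t, unitI t -> H (t, 0) = f t /\ H (t, 1) = g t,
      forall s, unitI s -> H (0, s) = f 0 /\ H (1, s) = f 1 &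
      forall s, unitI s -> exit_path (fun t => H (t, s))].

Definition exit_path_homotopy (H : R * R -> X) : Prop :=
  exit_path_homotopy_between (fun t => H (t, 0)) (fun t => H (t, 1)) H.

(* The case p = q, of a path inside a single stratum, is included: both
   endpoints of such a path lie in the same stratum, so no exit path homotopic
   to it rel endpoints satisfies p < q. When the endpoints lie in different
   strata, p < q holds: see immediately_exiting_path_lt. *)
Definition immediately_exiting_path (f : R -> X) : Prop :=
  exit_path f /\
  exists p q : P, [/\ (p <= q)%O, S (f 0) = p &
                      forall t, unitI t -> 0 < t -> S (f t) = q].

Lemma immediately_exiting_path_lt (f : R -> X) :
  immediately_exiting_path f -> S (f 0) != S (f 1) ->
  exists p q : P, [/\ (p < q)%O, S (f 0) = p &
                      forall t, unitI t -> 0 < t -> S (f t) = q].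
Proof.
move=> [_ [p [q [pq fp fq]]]] neq; exists p, q; split=> //.
by rewrite lt_neqAle pq andbT -fp -(fq 1)// /unitI /= in_itv/= lexx ler01.
Qed.

Definition immediately_exiting_homotopy (H : R * R -> X) : Prop :=
  exit_path_homotopy H /\
  forall s, unitI s -> immediately_exiting_path (fun t => H (t, s)).

End ExitPaths.

Definition lift_along (R : realType) (X Y : topologicalType) (p : Y -> X)
    (H : R * R -> X) (L : R * R -> Y) : Prop :=
  {within unitI `*` unitI, continuous L} /\
  forall z, (unitI `*` unitI) z -> p (L z) = H z.

(* Main.v *)
Require Import Defs.
From HB Require Import structures.
From mathcomp Require Import all_boot all_order all_algebra all_fingroup.
From mathcomp Require Import all_classical all_reals all_analysis.
From mathcomp Require Import generic_quotient.
From mathcomp Require Import ring lra.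
Import Order.TTheory GRing.Theory Num.Theory.
Import numFieldNormedType.Exports.
Set Implicit Arguments.
Unset Strict Implicit.
Unset Printing Implicit Defensive.
Local Open Scope classical_set_scope.
Local Open Scope ring_scope.
Local Open Scope quotient_scope.

(** Everything happens upstairs, in M. Write G_x for the stabiliser of x.

    Lifting. Every x in M has arbitrarily small slices: open neighbourhoods U
    that are stable under G_x and disjoint from their translates by the other
    elements of G ([slice_exists]). Along an exit path f of M/G the stabilisers
    can only shrink, while near any point they are no larger than at that point;
    so just before a time t the orbit type equals that of f t. In a slice around
    a point x over f t there is only one point of that type in each orbit
    ([slice_pi_inj]), so a lift that has reached x going backwards continues
    uniquely to the left ([lift_step]). At the left end of an open interval, the
    translates of a slice around the points of the fibre are disjoint, so the
    lift converges ([lift_limit]). Hence exit paths lift from any point over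
    their endpoint ([exit_path_lift]). In an exit path homotopy the members share
    their endpoint; lifting each of them from one point over it gives a jointly
    continuous map ([exit_homotopy_lift]).

    Pushing off. Let c be the lift of an exit path. Its stabilisers decrease
    along c, down to H = G_(c 1). It is enough to find a continuous e with
    e (r, 0) = c r and with stabiliser H at e (r, a) for all a > 0: then
    t |-> e (t, a t (1 - t)), for a from 0 to 1, is an exit path homotopy rel
    endpoints from c to an immediately exiting path ([push_homotopy]). The map e
    is built backwards from r = 1. This is where smoothness enters: by Bochner
    averaging, the action of G_x near x is linear in a suitable chart
    ([linear_slice_exists]). Suppose that e is known at r = b, and that c stays
    in such a chart on [a, b], with constant stabiliser K on ]a, b]. For the
    elements of K, translating by a vector fixed by K changes nothing, so
    c r + (e (b, .) - c b) has the same stabiliser in K as e (b, .). The other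
    elements of G_x move c r, and they still move the translated point if the
    displacement e (b, .) - c b is scaled down by a factor that tends to 0 as c r
    gets close to their fixed points ([pushable_step]). This factor may vanish at
    r = a, which is cured by sliding along the path while pushing
    ([pushable_left]).

    Part (2) asks nothing of the deformation along the sides s = 0 and s = 1 of
    the square, so H can first be contracted in the direction of s to the
    constant family H (., 0), whose single member is then pushed off. *)

(** * Backward induction, clamping and gluing *)

(** [lra] looks for an order on the type of every equation in the context, so
    the equations between points of a space are dropped first. *)
Ltac order_lra R := repeat match goal with
  | H : @eq ?T _ _ |- _ => tryif unify T R then fail else clear H
  end; lra.

Section RealLine.
Variable R : realType.

(** Real induction from right to left: an assertion that reaches the left end of
    every interval ]t, b] on which it holds, and that always spreads a little
    further to the left, holds on the whole half-line. At t = b the interval is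
    empty, so the first clause also starts the induction. *)
Lemma real_ind_down (b : R) (P : R -> Prop) :
  (forall t, t <= b -> (forall u, t < u -> u <= b -> P u) -> P t) ->
  (forall t, t <= b -> P t ->
    exists2 e, 0 < e & forall u, t - e < u -> u < t -> P u) ->
  forall t, t <= b -> P t.
Proof.
move=> lim step t0 t0b; apply: contrapT => nPt0.
pose E := [set u | u <= b /\ ~ P u].
have supE : has_sup E by split; [exists t0 | exists b => u []].
have sb : sup E <= b by apply: ge_sup; [exists t0 | move=> u []].
have Ps : P (sup E).
  apply: lim => // u su ub; apply: contrapT => nPu.
  by have := sup_upper_bound supE (conj ub nPu : E u); rewrite leNgt su.
have [e e0 Pe] := step _ sb Ps.
have [u [ub nPu] su] := sup_adherent e0 supE.
have := sup_upper_bound supE (conj ub nPu : E u).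
rewrite le_eqVlt => /orP[/eqP us|us]; first by apply: nPu; rewrite us.
exact: nPu (Pe _ su us).
Qed.

Lemma near_itv (t : R) (Q : R -> Prop) : (\forall r \near t, Q r) ->
  exists2 e, 0 < e & forall r, t - e < r -> r < t + e -> Q r.
Proof.
move=> /nbhs_ballP[e /= e0 Qe]; exists e => // r r1 r2; apply: Qe.
by rewrite /ball/= ltr_norml; apply/andP; split; lra.
Qed.

Lemma itv_near (t e : R) (Q : R -> Prop) : 0 < e ->
  (forall r, t - e < r -> r < t + e -> Q r) -> \forall r \near t, Q r.
Proof.
move=> e0 Qe; apply/nbhs_ballP; exists e => //= r.
by rewrite /ball/= ltr_norml => /andP[? ?]; apply: Qe; lra.
Qed.

Lemma near_itv2 (t s : R) (Q : R * R -> Prop) : (\forall z \near (t, s), Q z) ->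
  exists2 e, 0 < e & forall r v, t - e < r -> r < t + e ->
    s - e < v -> v < s + e -> Q (r, v).
Proof.
move=> /nbhs_ballP[e /= e0 Qe]; exists e => // r v *; apply: Qe.
by split; rewrite /ball/= ltr_norml; apply/andP; split; lra.
Qed.

Lemma itv2_near (t s e : R) (Q : R * R -> Prop) : 0 < e ->
  (forall r v, t - e < r -> r < t + e -> s - e < v -> v < s + e -> Q (r, v)) ->
  \forall z \near (t, s), Q z.
Proof.
move=> e0 Qe; apply/nbhs_ballP; exists e => //= -[r v] [/=].
by rewrite /ball/= !ltr_norml => /andP[? ?] /andP[? ?]; apply: Qe; lra.
Qed.

Lemma right_of (t b e : R) : t < b -> 0 < e ->
  exists u, [/\ t < u, u <= b & u < t + e].
Proof.
move=> tb e0; have [h|h] := ltP b (t + e / 2).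
  by exists b; split=> //; lra.
by exists (t + e / 2); split=> //; lra.
Qed.

Lemma min_le (a b : R) : Num.min a b <= a /\ Num.min a b <= b.
Proof. by rewrite !ge_min !lexx orbT. Qed.

Lemma min_gt0 (a b : R) : 0 < a -> 0 < b -> 0 < Num.min a b.
Proof. by move=> a0 b0; rewrite lt_min a0 b0. Qed.

(** Composing with [clamp 0 1] turns maps that are continuous within the unit
    interval into continuous maps on the line, constant outside the interval. *)
Definition clamp (a b t : R) : R := Num.max a (Num.min b t).

Lemma clamp_itv (a b t : R) : a <= b -> a <= clamp a b t <= b.
Proof. by move=> ab; rewrite /clamp le_max lexx/= ge_max ab ge_min lexx. Qed.

Lemma clamp_id (a b t : R) : a <= t <= b -> clamp a b t = t.
Proof. by move=> /andP[ab tb]; rewrite /clamp min_r ?max_r. Qed.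

Lemma clamp_le (a b t : R) : a <= b -> t <= a -> clamp a b t = a.
Proof. by move=> ab ta; rewrite /clamp min_r ?max_l // (le_trans ta ab). Qed.

Lemma clamp_ge (a b t : R) : a <= b -> b <= t -> clamp a b t = b.
Proof. by move=> ab bt; rewrite /clamp min_l ?max_r. Qed.

Lemma clamp_mono (a b s t : R) : s <= t -> clamp a b s <= clamp a b t.
Proof.
move=> st; rewrite /clamp; have: Num.min b s <= Num.min b t.
  by case: (ltP b s); case: (ltP b t); lra.
by move: (Num.min b s) (Num.min b t) => x y; case: (ltP a x); case: (ltP a y); lra.
Qed.

Lemma clamp_continuous (a b : R) : continuous (clamp a b).
Proof.
move=> t; rewrite /clamp.
apply: (@continuous_max _ R (cst a) (fun t => Num.min b t)).
  exact: cvg_cst.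
by apply: (@continuous_min _ R (cst b) id); [exact: cvg_cst | exact: cvg_id].
Qed.

End RealLine.

Lemma continuous_near (X Y : topologicalType) (f : X -> Y) (x : X) (N : set Y) :
  {for x, continuous f} -> nbhs (f x) N -> \forall y \near x, N (f y).
Proof. by move=> cf fN; exact: cf. Qed.

Lemma continuous_pair (X Y Z : topologicalType) (f : X -> Y) (g : X -> Z) x :
  {for x, continuous f} -> {for x, continuous g} ->
  {for x, continuous (fun x => (f x, g x))}.
Proof. by move=> cf cg; exact: (@cvg_pair _ _ _ _ _ _ _ _ _ _ _ cf cg). Qed.

Section Gluing.
Variables (R : realType) (X Y : topologicalType).

Lemma glue_continuous (h : X -> R) (t : R) (a b : X -> Y) :
  continuous h -> continuous a -> continuous b ->
  (forall x, h x = t -> a x = b x) ->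
  continuous (fun x => if h x <= t then a x else b x).
Proof.
move=> ch ca cb ab x N /=.
have nl (x0 : X) : h x0 < t -> \forall y \near x0, h y <= t.
  move=> lt; have : \forall r \near h x0, r < t by exact: lt_nbhsl.
  by move=> /(continuous_near (ch x0)); apply: filterS => y /ltW.
have nr (x0 : X) : t < h x0 -> \forall y \near x0, ~~ (h y <= t).
  move=> lt; have : \forall r \near h x0, t < r by exact: lt_nbhsr.
  by move=> /(continuous_near (ch x0)); apply: filterS => y; rewrite -ltNge.
have [lt|gt|eq] := ltgtP (h x) t => NN; rewrite nbhs_filterE.
- apply: filterS2 (nl _ lt) (continuous_near (ca x) NN) => y yt ay /=.
  by rewrite yt.
- apply: filterS2 (nr _ gt) (continuous_near (cb x) NN) => y /negbTE yt ay /=.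
  by rewrite yt.
- have NN' := NN; rewrite (ab _ eq) in NN'.
  apply: filterS2 (continuous_near (ca x) NN) (continuous_near (cb x) NN') => y ay by'.
  by rewrite /=; case: ifP.
Qed.

Lemma within_continuous_comp (Z : topologicalType) (A : set X) (f : X -> Y)
    (h : Z -> X) :
  {within A, continuous f} -> continuous h -> (forall z, A (h z)) ->
  continuous (f \o h).
Proof.
move=> /subspace_continuousP cf ch Ah z N fN.
have /(continuous_near (ch z)) := cf _ (Ah z) _ fN.
by apply: filterS => y /=; exact.
Qed.

End Gluing.

(** * Slices of the action *)

Section Orbits.
Variables (R : realType) (n : nat) (M : manifold R n) (gT : finGroupType).
Variable act : smooth_action M gT.

Lemma smact_continuous g : continuous (act g).
Proof. by have [] := smact_smooth act g. Qed.

Lemma smactKV g : cancel (act g^-1%g) (act g).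
Proof. by move=> x; rewrite -smactM mulgV smact1. Qed.

Lemma orbit_pi_act g x : orbit_pi act (act g x) = orbit_pi act x.
Proof. by apply/esym/orbit_piP; exists g. Qed.

Lemma orbit_pi_continuous : continuous (orbit_pi act).
Proof. exact: pi_continuous. Qed.

Lemma orbit_pi_open (U : set M) : open U -> open (orbit_pi act @` U).
Proof.
move=> oU; rewrite /open /= /quotient_open /=.
have -> : (\pi_{eq_quot (orbit_rel act)} @^-1` (orbit_pi act @` U))
    = \bigcup_(g in [set: gT]) (act g @^-1` U).
  rewrite predeqE => x; split=> [[u Uu /orbit_piP[g e]]|[g _ Ux]].
    by exists g^-1%g => //=; rewrite -e smactK.
  by exists (act g x) => //; exact: orbit_pi_act.
apply: bigcup_open => g _.
by apply: open_comp => // x _; exact: smact_continuous.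
Qed.

(** An inclusion of stabilisers whose conjugacy classes compare the other way is
    an equality, as conjugate subgroups have the same cardinal. *)
Lemma stab_le_card (x y : M) : (stab_type act y <= stab_type act x)%O ->
  stab act y \subset stab act x -> stab act y = stab act x.
Proof.
rewrite leEdual conj_class_le => /existsP[g] /subset_leq_card; rewrite cardJg.
by move=> card sub; apply/eqP; rewrite eqEcard sub card.
Qed.

Lemma stab_type_sub (x y : M) :
  stab act x \subset stab act y -> (stab_type act y <= stab_type act x)%O.
Proof.
move=> sub; rewrite leEdual conj_class_le; apply/existsP; exists 1%g.
by rewrite conjsg1.
Qed.

Lemma stab_type_eq (x y : M) :
  stab act x = stab act y -> stab_type act x = stab_type act y.
Proof. by move=> e; apply/le_anti; rewrite !stab_type_sub ?e. Qed.

(** For finite groups this is a slice in the usual sense: the union of the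
    translates of U is the twisted product of G and U over the stabiliser of x,
    so U modulo the stabiliser is an open subset of the orbit space. *)
Definition slice (x : M) (U : set M) : Prop :=
  [/\ open U, U x, (forall g u, g \in stab act x -> U u -> U (act g u)) &
      (forall g u, U u -> U (act g u) -> g \in stab act x)].

Lemma slice_stab x U u : slice x U -> U u -> stab act u \subset stab act x.
Proof.
move=> [_ _ _ sep] Uu; apply/fintype.subsetP => g.
by rewrite inE => /eqP gu; apply: (sep g u) => //; rewrite gu.
Qed.

(** For each g outside the stabiliser, separating x from g x yields a
    neighbourhood disjoint from its translate by g. The slice consists of the
    points whose whole orbit under the stabiliser stays in all of these. *)
Lemma slice_exists (x : M) (N : set M) : nbhs x N ->
  exists2 U, slice x U & U `<=` N.
Proof.
move=> Nx.
have sepW (g : gT) : exists W : set M, [/\ open W, W x &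
    g \notin stab act x -> forall u, W u -> ~ W (act g u)].
  have [gx|gx] := boolP (g \in stab act x); last first.
    have neq : act g x != x by move: gx; rewrite inE.
    have := @manifold_hausdorff _ _ M; rewrite open_hausdorff.
    move=> /(_ _ _ neq)[[A B] /= [/set_mem xA /set_mem xB] [oA oB /eqP AB]].
    exists (B `&` act g @^-1` A); split=> //.
    - apply: openI => //; apply: open_comp => // u _; exact: smact_continuous.
    - move=> _ u [_ Agu] [Bgu _].
      by have : (A `&` B) (act g u) by []; rewrite AB.
  by exists setT; split=> //; exact: openT.
have [W Wp] := choice sepW.
pose U0 := N^° `&` [set u | forall g, W g u].
have oU0 : open U0.
  apply: openI; first exact: open_interior.
  rewrite openE => u Wu; apply: filter_forall => g.
  by have [oW _ _] := Wp g; apply: open_nbhs_nbhs.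
have U0x : U0 x by split=> // g; have [] := Wp g.
exists [set u | forall h, h \in stab act x -> U0 (act h u)]; last first.
  move=> u /(_ 1%g); rewrite smact1 => -[|/interior_subset //].
  exact: (group1 (stab_group act x)).
split.
- rewrite openE => u Uu; apply: filter_forall => h.
  have [hx|hx] := boolP (h \in stab act x); last by apply: nearW => v.
  have /(continuous_near (smact_continuous (x := u))) : nbhs (act h u) U0.
    by apply: open_nbhs_nbhs; split=> //; exact: Uu.
  by apply: filterS.
- by move=> h; rewrite inE => /eqP ->.
- move=> g u gx Uu h hx; rewrite -smactM; apply: Uu.
  exact: (groupM (G := stab_group act x)).
- move=> g u Uu Ugu; apply: contrapT => /negP ngx.
  have stab1 : 1%g \in stab act x by exact: (group1 (stab_group act x)).
  have [_ /(_ g) Wu] := Uu _ stab1; have [_ /(_ g) Wgu] := Ugu _ stab1.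
  move: Wu Wgu; rewrite !smact1.
  by have [_ _ sepg] := Wp g; apply: sepg.
Qed.

Lemma slice_translate x U g : slice x U ->
  slice (act g x) (act g^-1%g @^-1` U).
Proof.
move=> [oU Ux inv sep]; split.
- by apply: open_comp => // u _; exact: smact_continuous.
- by rewrite /= smactK.
- move=> h u; rewrite inE => /eqP hx Uu.
  rewrite /= -smactM -[u in X in U X](smactKV g u) -smactM.
  apply: inv => //.
  by rewrite inE !smactM hx smactK.
- move=> h u /= Uu Uhu.
  have /(sep (g^-1 * h * g)%g _ Uu) : U (act (g^-1 * h * g)%g (act g^-1%g u)).
    by rewrite !smactM smactKV.
  rewrite !inE !smactM => /eqP e; apply/eqP.
  by rewrite -{2}e smactKV.
Qed.

(** The condition on types forces the stabiliser of u to be all of that of x,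
    and u and v differ by an element of the latter. *)
Lemma slice_pi_inj x U u v : slice x U -> U u -> U v ->
  (stab_type act u <= stab_type act x)%O ->
  orbit_pi act u = orbit_pi act v -> u = v.
Proof.
move=> sU Uu Uv ux /orbit_piP[g guv].
have su := stab_le_card ux (slice_stab sU Uu).
have [_ _ _ sep] := sU.
have : g \in stab act x by apply: (sep g u) => //; rewrite guv.
by rewrite -su inE guv => /eqP.
Qed.

(** When the two centres have the same stabiliser, a point of the large slice in
    the orbit of a point of the small one is already in the small one. This is
    what turns continuity in the orbit space into continuity of a lift. *)
Lemma slice_sub_fiber x U x' U' u v : slice x U -> slice x' U' -> U' `<=` U ->
  stab act x = stab act x' -> U u -> U' v -> orbit_pi act u = orbit_pi act v ->
  U' u.
Proof.
move=> [_ _ _ sep] [_ _ inv _] U'U e Uu Uv' /esym/orbit_piP[g gvu].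
rewrite -gvu; apply: inv => //; rewrite -e; apply: (sep g v); first exact: U'U.
by rewrite gvu.
Qed.

Lemma slice_pi_near x U : slice x U -> nbhs (orbit_pi act x) (orbit_pi act @` U).
Proof.
move=> [oU Ux _ _]; apply: open_nbhs_nbhs; split; first exact: orbit_pi_open.
by exists x.
Qed.

(** Over the image of U, the manifold splits into the translates of U, which are
    open and pairwise equal or disjoint; a path cannot jump between them. *)
Lemma slice_connected x U (l : R -> M) a b r0 : slice x U ->
  continuous l ->
  (forall r, a <= r <= b -> (orbit_pi act @` U) (orbit_pi act (l r))) ->
  a <= r0 <= b -> U (l r0) -> forall r, a <= r <= b -> U (l r).
Proof.
move=> [oU Ux inv sep] cl lU r0ab Ul0 r rab.
pose W := \bigcup_(g in [set g | g \notin stab act x]) (act g @^-1` U).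
have oW : open W.
  by apply: bigcup_open => g _; apply: open_comp => // u _; exact: smact_continuous.
have dis u : U u -> ~ W u.
  by move=> Uu [g /= /negP ngx Ugu]; apply: ngx; exact: (sep g u).
have cov s : a <= s <= b -> ~ W (l s) -> U (l s).
  move=> sab nW; have [u Uu /orbit_piP[g e]] := lU s sab.
  have [gx|gx] := boolP (g \in stab act x).
    by rewrite -e; exact: inv.
  exfalso; apply: nW; exists g^-1%g; last by rewrite /= -e smactK.
  by rewrite /= (groupV (stab_group act x)).
have /(_ (`[a, b] `&` l @^-1` U)) conn := @segment_connected R a b.
suff e : `[a, b] `&` l @^-1` U = `[a, b]%classic.
  by have [] : (`[a, b] `&` l @^-1` U)%classic r by rewrite e /= in_itv.
apply: conn.
- by exists r0; split=> //=; rewrite in_itv.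
- by exists (l @^-1` U) => //; apply: open_comp => // u _; exact: cl.
- exists (~` (l @^-1` W)).
    by apply: open_closedC; apply: open_comp => // u _; exact: cl.
  rewrite predeqE => s /=; rewrite in_itv /=; split=> -[sab]; split=> //.
    exact: dis.
  exact: cov.
Qed.

End Orbits.

(** * Lifting exit paths and their homotopies *)

Section Lifting.
Variables (R : realType) (n : nat) (M : manifold R n) (gT : finGroupType).
Variable act : smooth_action M gT.
Local Notation S := (orbit_strat act).
Local Ltac rlra := order_lra R.
Local Notation pi := (orbit_pi act).

(** Backward induction from b: the agreement set is closed by separation, and it
    is open to the left by [slice_pi_inj]. *)
Lemma lift_unique (f : R -> orbit_space act) (t0 b : R) (l1 l2 : R -> M) :
  (forall s t, s <= t -> (S (f s) <= S (f t))%O) ->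
  continuous l1 -> continuous l2 ->
  (forall r, t0 <= r -> pi (l1 r) = f r) ->
  (forall r, t0 <= r -> pi (l2 r) = f r) -> l1 b = l2 b ->
  forall r, t0 <= r <= b -> l1 r = l2 r.
Proof.
move=> mono c1 c2 p1 p2 eb r /andP[tr rb]; move: r rb tr.
apply: real_ind_down => t tb.
  move=> IH t0t; apply: contrapT => neq.
  have [tlt|] := ltP t b; last by move=> bt; apply: neq; have -> : t = b by rlra.
  have := @manifold_hausdorff _ _ M; rewrite open_hausdorff.
  move=> /(_ (l1 t) (l2 t))[|[A B] /= [/set_mem xA /set_mem xB] [oA oB /eqP AB]].
    exact/eqP.
  have nA : nbhs (l1 t) A by exact: open_nbhs_nbhs.
  have nB : nbhs (l2 t) B by exact: open_nbhs_nbhs.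
  have [e e0 He] := near_itv (filterI (continuous_near (c1 t) nA)
    (continuous_near (c2 t) nB)).
  have [u [tu ub ue]] := right_of tlt e0.
  have [||Au Bu] := He u; [rlra.. |].
  suff : (A `&` B) (l1 u) by rewrite AB.
  by split=> //; rewrite IH //; rlra.
move=> IH; have [e0|lt0] := ltP t0 t; last first.
  by exists 1 => // u *; exfalso; rlra.
have e := IH (ltW e0).
have [U sU _] := @slice_exists _ _ _ _ act (l1 t) setT filterT.
have [oU Ux _ _] := sU.
have nU : nbhs (l1 t) U by exact: open_nbhs_nbhs.
have nU2 : nbhs (l2 t) U by rewrite -e.
have [d d0 Hd] := near_itv (filterI (continuous_near (c1 t) nU)
    (continuous_near (c2 t) nU2)).
exists d => // u u1 u2 t0u.
have [||U1 U2] := Hd u; [rlra.. |].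
apply: (slice_pi_inj sU) => //; last by rewrite p1 ?p2.
by rewrite -!orbit_stratE p1 // p1 ?(ltW e0) //; apply: mono; rlra.
Qed.

(** The orbit type only determines the stabiliser up to conjugacy; along a
    continuous lift the stabilisers themselves decrease, because the stabiliser of
    a point contains those of all nearby points. *)
Lemma lift_stab_mono (l : R -> M) : continuous l ->
  (forall s t, s <= t -> (S (pi (l s)) <= S (pi (l t)))%O) ->
  forall s t, s <= t -> stab act (l t) \subset stab act (l s).
Proof.
move=> cl mono s t; move: s; apply: real_ind_down => s st.
  move=> IH; have [e e0 He] := near_itv (continuous_near (cl s) (stab_type_near act (l s))).
  have [stlt|] := ltP s t; last by move=> ts; have -> : t = s by rlra.
  have [u [su ut ue]] := right_of stlt e0.
  by apply: fintype.subset_trans (IH u su ut) _; apply: He; rlra.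
move=> IH.
have [e e0 He] := near_itv (continuous_near (cl s) (stab_type_near act (l s))).
exists e => // u u1 u2.
rewrite (@stab_le_card _ _ _ _ act (l s) (l u)) //; last by apply: He; rlra.
by rewrite -!orbit_stratE; apply: mono; rlra.
Qed.

(** A lift defined to the right of u, extended to the line arbitrarily. *)
Definition lifts_from (f : R -> orbit_space act) (y : M) (u : R) (l : R -> M) : Prop :=
  [/\ continuous l, forall r, u <= r -> pi (l r) = f r &
      forall r, 1 <= r -> l r = y].

(** The lifts over smaller intervals agree by uniqueness, hence define a lift
    [lm] over ]t, 1]. Close to t it stays in one translate of a slice centred on
    the fibre over f t, and it converges to the centre x of that translate. *)
Lemma lift_limit (f : R -> orbit_space act) (y : M) (t : R) : t <= 1 ->
  continuous f ->
  (forall s t, s <= t -> (S (f s) <= S (f t))%O) ->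
  (forall r, 1 <= r -> f r = pi y) ->
  (forall u, t < u -> u <= 1 -> exists l, lifts_from f y u l) ->
  exists l, lifts_from f y t l.
Proof.
move=> t1 cf mono fy ex.
have [tlt|] := ltP t 1; last first.
  move=> t1'; exists (fun _ => y); split=> //; first by move=> ?; exact: cvg_cst.
  by move=> r tr; rewrite fy //; rlra.
have [lu lu_lift] : exists lu : R -> R -> M, forall u, t < u -> u <= 1 ->
    lifts_from f y u (lu u).
  have := @choice R (R -> M) (fun u l => t < u -> u <= 1 -> lifts_from f y u l).
  case=> [u|lu H]; last by exists lu.
  have [tu|] := pselect (t < u /\ u <= 1).
    by have [l Hl] := ex u tu.1 tu.2; exists l.
  by move=> H; exists (fun _ => y) => a b; exfalso; apply: H.
pose lm r := lu (Num.min r 1) r.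
have limE u r : t < u -> u <= 1 -> u <= r -> lu u r = lm r.
  move=> tu u1 ur; rewrite /lm.
  have [cl pl ly] := lu_lift u tu u1.
  have [r1|r1] := leP r 1; last first.
    have [_ _ ly'] := lu_lift 1 tlt (lexx _).
    by rewrite ly ?ly' // ltW.
  have [cl' pl' ly'] := lu_lift r (lt_le_trans tu ur) r1.
  apply: (@lift_unique f r 1) => //; last by rlra.
    by move=> s rs; rewrite pl //; rlra.
  by rewrite ly ?ly'.
have limy r : 1 <= r -> lm r = y.
  move=> r1; rewrite /lm min_r //.
  by have [_ _ ->] := lu_lift 1 tlt (lexx _).
have limp r : t < r -> pi (lm r) = f r.
  move=> tr; have [r1|r1] := leP r 1; last by rewrite limy ?fy // ltW.
  by have [_ p _] := lu_lift r tr r1; rewrite /lm min_l // p.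
have [x0 fx0] : exists x0, pi x0 = f t.
  by exists (repr (f t)); exact: reprK.
have [U0 sU0 _] := @slice_exists _ _ _ _ act x0 setT filterT.
have [e e0 He] : exists2 e, 0 < e & forall r, t - e < r -> r < t + e ->
    (pi @` U0) (f r).
  apply: near_itv; apply: continuous_near (cf t) _.
  by rewrite -fx0; exact: slice_pi_near.
have [t' [tt' t'1 t'e]] := right_of tlt e0.
have [x [U [sU px eU Ut']]] : exists x U, [/\ slice act x U, pi x = f t,
    (forall r, t - e < r -> r < t + e -> (pi @` U) (f r)) & U (lm t')].
  have [||v Uv pv] := He t'; [rlra..|].
  have /orbit_piP[g gv] : pi v = pi (lm t') by rewrite pv limp.
  exists (act g x0), (act g^-1%g @^-1` U0); split.
  - exact: slice_translate.
  - by rewrite orbit_pi_act.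
  - move=> r r1 r2; have [w Uw pw] := He r r1 r2.
    exists (act g w); first by rewrite /= smactK.
    by rewrite orbit_pi_act.
  - by rewrite /= -gv smactK.
have limU r : t < r -> r <= t' -> U (lm r).
  move=> tr rt'.
  have [cl pl ly] := lu_lift r tr (le_trans rt' t'1).
  have r1 := le_trans rt' t'1.
  rewrite -(limE r) //.
  apply: (@slice_connected _ _ _ _ act x U (lu r) r t' t') => //.
  - by move=> s /andP[rs st]; rewrite pl //; apply: eU; rlra.
  - by apply/andP; split; rlra.
  - by rewrite (limE r).
  - by apply/andP; split; rlra.
exists (fun r => if r <= t then x else lm r).
split.
- move=> r; have [rt|tr|rt] := ltgtP r t.
  + have near_x : \forall s \near r, (if s <= t then x else lm s) = x.
      have : \forall s \near r, s < t by exact: lt_nbhsl.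
      by apply: filterS => s /ltW ->.
    move=> N /=; rewrite (ltW rt) => Nx; rewrite nbhs_filterE.
    by apply: filterS near_x => s /= ->; exact: nbhs_singleton.
  + have [u [tu u1 ur]] : exists u, [/\ t < u, u <= 1 & u < r].
      have [|u [tu u1 ur]] := @right_of R t 1 (r - t) tlt; first rlra.
      by exists u; split=> //; rlra.
    have [cl pl ly] := lu_lift u tu u1.
    have near_l : \forall s \near r, (if s <= t then x else lm s) = lu u s.
      have : \forall s \near r, u < s by exact: lt_nbhsr.
      apply: filterS => s us; rewrite leNgt (lt_trans tu us)/= limE //.
      exact: ltW.
    move=> N /=; rewrite leNgt tr /= -(limE u) // ?(ltW ur)// => Nx; rewrite nbhs_filterE.
    have := continuous_near (cl r) Nx.
    by apply: filterS2 near_l => s /= ->.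
  + subst r; move=> N /=; rewrite lexx => Nx; rewrite nbhs_filterE.
    have NU : nbhs x (N `&` U).
      by apply: filterI => //; have [oU Ux _ _] := sU; exact: open_nbhs_nbhs.
    have [U' sU' U'NU] := slice_exists act NU.
    have [d d0 Hd] : exists2 e, 0 < e & forall r, t - e < r -> r < t + e ->
        (pi @` U') (f r).
      apply: near_itv; apply: continuous_near (cf t) _.
      by rewrite -px; exact: slice_pi_near.
    have d1 : 0 < t' - t by rlra.
    apply: (itv_near (min_gt0 d0 d1)).
    move=> s s1 s2 /=; have [st|ts] := leP s t; first exact: nbhs_singleton.
    suff /U'NU [] : U' (lm s) by [].
    have [sd st'] : s < t + d /\ s < t'.
      by have [] := min_le d (t' - t); rlra.
    have [||v Uv pv] := Hd s; [rlra..|].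
    apply: (slice_sub_fiber sU sU' _ _ _ Uv) => //.
    * by move=> w /U'NU[].
    * by apply: limU => //; rlra.
    * by rewrite pv limp.
- move=> r tr; case: (leP r t) => rt; last exact: limp.
  by have -> : r = t by rlra.
- by move=> r r1; rewrite leNgt (lt_le_trans tlt r1) /= limy.
Qed.

(** To the left of t, but close to it, the slice at l t contains exactly one point
    over each f r; choosing it defines a continuous lift. *)
Lemma lift_step (f : R -> orbit_space act) (y : M) (t : R) :
  continuous f ->
  (forall s t, s <= t -> (S (f s) <= S (f t))%O) ->
  t <= 1 -> (exists l, lifts_from f y t l) ->
  exists2 e, 0 < e & forall u, t - e < u -> u < t -> exists l, lifts_from f y u l.
Proof.
move=> cf mono t1 [l [cl pl ly]].
have [U sU _] := @slice_exists _ _ _ _ act (l t) setT filterT.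
have [oU Ux _ _] := sU.
have [e e0 He] : exists2 e, 0 < e & forall r, t - e < r -> r < t + e ->
    (pi @` U) (f r).
  apply: near_itv; apply: continuous_near (cf t) _.
  by rewrite -pl //; exact: slice_pi_near.
exists e => // u ue ut.
have cl_in r : u <= clamp u t r <= t by apply: clamp_itv; exact: ltW.
have [m mP] : exists m : R -> M, forall r, U (m r) /\ pi (m r) = f (clamp u t r).
  have [r|m mP] := @choice R M (fun r x => U x /\ pi x = f (clamp u t r));
    last by exists m.
  have /andP[? ?] := cl_in r.
  by have [||x] := He (clamp u t r); [rlra.. | move=> Ux' px; exists x].
have le_t r : (stab_type act (m r) <= stab_type act (l t))%O.
  rewrite -!orbit_stratE (mP r).2 pl //; apply: mono.
  by have := cl_in r; rlra.
have cm : continuous m.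
  move=> r N Nm; rewrite nbhs_filterE.
  have NU : nbhs (m r) (N `&` U).
    by apply: filterI => //; apply: open_nbhs_nbhs; split=> //; exact: (mP r).1.
  have [U' sU' U'NU] := slice_exists act NU.
  have nf : nbhs (f (clamp u t r)) (pi @` U').
    by rewrite -(mP r).2; exact: slice_pi_near.
  have := continuous_near (@clamp_continuous R u t r) (continuous_near (cf _) nf).
  apply: filterS => s [v Uv' pv] /=.
  have [Nv Uv] := U'NU _ Uv'.
  suff -> : m s = v by [].
  by apply: (slice_pi_inj sU) => //; [exact: (mP s).1 | rewrite (mP s).2 pv].
exists (fun r => if r <= t then m r else l r); split.
- apply: (@glue_continuous R R M id) => //; first by move=> ?; exact: cvg_id.
  move=> r /= ->; apply: (slice_pi_inj sU) => //; first exact: (mP t).1.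
  by rewrite (mP t).2 clamp_id ?pl // lexx ltW.
- move=> r ur; case: leP => rt; last by rewrite pl // ltW.
  by rewrite (mP r).2 clamp_id // ur rt.
- move=> r r1; case: leP => rt; last exact: ly.
  have <- : l r = y by exact: ly.
  have -> : r = t by rlra.
  apply: (slice_pi_inj sU) => //; first exact: (mP t).1.
  by rewrite (mP t).2 clamp_id ?pl // lexx ltW.
Qed.

(** The conditions outside [0, 1] hold for paths composed with a clamp. *)
Lemma exit_path_lift (f : R -> orbit_space act) (y : M) :
  continuous f ->
  (forall s t, s <= t -> (S (f s) <= S (f t))%O) ->
  (forall r, r <= 0 -> f r = f 0) ->
  (forall r, 1 <= r -> f r = pi y) ->
  exists l : R -> M, [/\ continuous l, forall r, pi (l r) = f r & l 1 = y].
Proof.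
move=> cf mono f0 f1.
have [l [cl pl ly]] : exists l, lifts_from f y 0 l.
  apply: (@real_ind_down R 1 (fun t => exists l, lifts_from f y t l)) => //.
  - move=> t t1; exact: lift_limit.
  - move=> t t1; exact: lift_step.
exists (fun r => l (Num.max 0 r)); split.
- move=> r; apply: (@continuous_comp R R M (Num.max 0) l); last exact: cl.
  apply: (@continuous_max _ R (cst 0) id); first exact: cvg_cst.
  exact: cvg_id.
- move=> r; rewrite pl ?le_max ?lexx //.
  have [r0|r0] := leP 0 r; first by [].
  by rewrite [RHS]f0 // ltW.
- by rewrite max_r ?ler01 // ly.
Qed.

(** The lifts of the members, all ending at y, are put side by side. Continuity
    at (t, v) is proved by backward induction on t: it reaches the end t of ]t, 1]
    because connectedness keeps the neighbouring lifts in the slice where they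
    are slightly later, and it propagates to the left because the stabiliser
    along the lift for v is constant just before t. *)
Lemma exit_homotopy_lift (K : R * R -> orbit_space act) (y : M) :
  continuous K ->
  (forall v s t, s <= t -> (S (K (s, v)) <= S (K (t, v)))%O) ->
  (forall v r, r <= 0 -> K (r, v) = K (0, v)) ->
  (forall v r, 1 <= r -> K (r, v) = pi y) ->
  exists L : R * R -> M, [/\ forall t v, t <= 1 -> {for (t, v), continuous L},
    forall z, pi (L z) = K z & forall v, L (1, v) = y].
Proof.
move=> cK mono K0 K1.
have [Lc LcP] : exists Lc : R -> R -> M, forall v, [/\ continuous (Lc v),
    forall r, pi (Lc v r) = K (r, v) & Lc v 1 = y].
  have [v|Lc LcP] := @choice R (R -> M) (fun v l => [/\ continuous l,
    forall r, pi (l r) = K (r, v) & l 1 = y]); last by exists Lc.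
  apply: exit_path_lift => [r|s t|r r0|r r1]; [|exact: mono|exact: K0|exact: K1].
  apply: (@continuous_comp R (R * R)%type _ (fun r => (r, v)) K); last exact: cK.
  by apply: continuous_pair; [exact: cvg_id | exact: cvg_cst].
exists (fun z => Lc z.2 z.1); split; last 2 first.
- by case=> r v; have [_ ->] := LcP v.
- by move=> v; have [] := LcP v.
move=> t v; move: t; have [cl pl ly] := LcP v.
apply: real_ind_down => t t1.
- move=> IH N /= Nx; rewrite nbhs_filterE.
  have [U sU UN] := slice_exists act Nx; have [oU Ux _ _] := sU.
  have nU : nbhs (Lc v t) U by exact: open_nbhs_nbhs.
  have [e e0 He] : exists2 e, 0 < e & forall r w, t - e < r -> r < t + e ->
      v - e < w -> w < v + e -> (pi @` U) (K (r, w)).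
    apply: (@near_itv2 R t v (fun z => (pi @` U) (K z))).
    apply: continuous_near (cK _) _; rewrite -pl.
    exact: slice_pi_near.
  have [t' [t't t'e [d d0 Hd]]] : exists t', [/\ t <= t', t' < t + e &
     exists2 d, 0 < d & forall w, v - d < w -> w < v + d -> U (Lc w t')].
    have [tlt|] := ltP t 1; last first.
      move=> t1'; have e1 : t = 1 by rlra.
      exists t; split=> //; first by rlra.
      exists 1 => // w _ _; move: Ux; rewrite e1 ly.
      by have [_ _ ->] := LcP w.
    have [d d0 Hd] := near_itv (continuous_near (cl t) nU).
    have [m1 m2] := min_le e d.
    have [t' [tt' t'1 t'd]] := right_of tlt (min_gt0 e0 d0).
    exists t'; split; [rlra..|].
    have Ut' : U (Lc v t') by apply: Hd; rlra.
    have nUt' : nbhs (Lc v t') U by exact: open_nbhs_nbhs.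
    have [c c0 Hc] := near_itv2 (continuous_near (IH _ tt' t'1) nUt').
    by exists c => // w w1 w2; apply: (Hc t' w) => //; rlra.
  have e20 : 0 < e / 2 by rlra.
  apply: (itv2_near (min_gt0 e20 d0)).
  move=> r w r1 r2 w1 w2 /=; apply: UN.
  have [m1 m2] := min_le (e / 2) d.
  have [clw plw lyw] := LcP w.
  pose a := t - e / 2.
  have [b [bt bt' be]] : exists b, [/\ t + e / 2 <= b, t' <= b & b < t + e].
    have [h|h] := leP t' (t + e / 2).
      by exists (t + e / 2); split=> //; rlra.
    by exists t'; split=> //; rlra.
  apply: (@slice_connected _ _ _ _ act (Lc v t) U (Lc w) a b t') => //.
  + by move=> s /andP[as' sb]; rewrite plw; apply: He; move: as'; rewrite /a; rlra.
  + by rewrite /a; apply/andP; split=> //; rlra.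
  + by apply: Hd; rlra.
  + by rewrite /a; apply/andP; split; rlra.
- move=> IH.
  have [U sU _] := @slice_exists _ _ _ _ act (Lc v t) setT filterT.
  have [oU Ux _ _] := sU.
  have nU : nbhs (Lc v t) U by exact: open_nbhs_nbhs.
  have cL : {for (t, v), continuous (fun z : R * R => Lc z.2 z.1)} by exact: IH.
  have [e e0 He] := near_itv2 (continuous_near cL nU).
  exists e => // u u1 u2 N /= Nu; rewrite nbhs_filterE.
  have Uu : U (Lc v u) by apply: (He u v); rlra.
  have NU : nbhs (Lc v u) (N `&` U).
    by apply: filterI => //; exact: open_nbhs_nbhs.
  have [U' sU' U'NU] := slice_exists act NU.
  have se : stab act (Lc v u) = stab act (Lc v t).
    apply: stab_le_card (slice_stab sU Uu).
    by rewrite -!orbit_stratE !pl; apply: mono; rlra.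
  have nK : \forall z \near (u, v), (pi @` U') (K z).
    by apply: continuous_near (cK _) _; rewrite -pl; exact: slice_pi_near.
  have nI : \forall z \near (u, v), t - e < z.1 /\ z.1 < t + e /\
      v - e < z.2 /\ z.2 < v + e.
    have [d1 d2] : 0 < t - u /\ 0 < u - (t - e) by rlra.
    apply: (itv2_near (min_gt0 e0 (min_gt0 d1 d2))) => r w /=.
    have [+ +] := min_le e (Num.min (t - u) (u - (t - e))).
    have [+ +] := min_le (t - u) (u - (t - e)).
    rlra.
  apply: filterS2 nK nI => -[r w] /= [x Ux' px] [r1 [r2 [w1 w2]]].
  suff /U'NU [] : U' (Lc w r) by [].
  apply: (slice_sub_fiber sU sU' _ _ _ Ux') => //.
  + by move=> z /U'NU[].
  + exact: (He r w).
  + by have [_ -> _] := LcP w.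
Qed.

End Lifting.

(** * Local inversion of maps close to the identity *)

Section StrictDifferentiability.
Variables (R : realType) (n : nat).
Local Notation V := 'rV[R]_n.

Lemma rV_norm_le (x : V) (c : R) : 0 <= c -> (forall j, `|x 0 j| <= c) -> `|x| <= c.
Proof.
move=> c0 xc; rewrite {1}/Num.Def.normr /= mx_normrE.
by apply: bigmax_le => // -[i j] _ /=; rewrite (ord1 i).
Qed.

Lemma coord_norm_le (x : V) j : `|x 0 j| <= `|x|.
Proof.
rewrite [leRHS]/Num.Def.normr /= mx_normrE.
exact: (@le_bigmax _ _ _ 0 (fun ij => `|x ij.1 ij.2|) (0, j)).
Qed.

Lemma is_derive_line (f : V -> V) (z v : V) (s : R) :
  differentiable f (z + s *: v) ->
  is_derive s (1 : R) (fun s => f (z + s *: v)) ('d f (z + s *: v) v).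
Proof.
move=> df.
have e : (fun h : R => h^-1 *:
      (((fun s => f (z + s *: v)) \o shift s) (h *: (1 : R)) - f (z + s *: v)))
   = (fun h => h^-1 *: ((f \o shift (z + s *: v)) (h *: v) - f (z + s *: v))).
  apply/funext => h /=; congr (_ *: (f _ - _)).
  have -> : h *: (1 : R) = h by exact: mulr1.
  by rewrite scalerDl addrCA.
have dv := @diff_derivable _ _ _ f _ v df.
apply: DeriveDef; first by rewrite /derivable e.
by rewrite -deriveE // /derive e.
Qed.

(** Continuity of the finitely many partial derivatives gives continuity of the
    differential in operator norm. *)
Lemma diff_near (f : V -> V) (U : set V) (z0 : V) (e : R) : open U -> U z0 ->
  Ck 1 U f -> 0 < e ->
  \forall z \near z0, U z /\ forall v, `|'d f z v - 'd f z0 v| <= e * `|v|.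
Proof.
move=> oU Uz0 [df cdf] e0.
pose e' := e / n.+1%:R.
have e'0 : 0 < e' by rewrite divr_gt0.
have nU : \forall z \near z0, U z by exact: open_nbhs_nbhs.
have nD : \forall z \near z0, forall j : 'I_n,
    `|'D_(delta_mx 0 j) f z0 - 'D_(delta_mx 0 j) f z| < e'.
  apply: (@filter_forall _ 'I_n (fun j z =>
    `|'D_(delta_mx 0 j) f z0 - 'D_(delta_mx 0 j) f z| < e') (nbhs z0)) => j.
  by have /cvgrPdist_lt := cdf (delta_mx 0 j) z0 Uz0; apply.
apply: filterS2 nU nD => z Uz Dz; split=> // v.
have dE w : U w -> 'd f w v = \sum_j v 0 j *: 'D_(delta_mx 0 j) f w.
  move=> Uw; rewrite {1}(row_sum_delta v) linear_sum; apply: eq_bigr => j _.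
  rewrite linearZ deriveE; first by [].
  exact: df.
have -> := congr2 (fun a b : V => a - b) (dE z Uz) (dE z0 Uz0).
rewrite -sumrB.
apply: (@le_trans _ _ (\sum_(j < n) e' * `|v|)).
  apply: le_trans (ler_norm_sum _ _ _) _; apply: ler_sum => j _.
  rewrite -scalerBr normrZ mulrC ler_pM //.
    by have := Dz j; rewrite distrC => /ltW.
  exact: coord_norm_le.
rewrite sumr_const card_ord -mulrnAl ler_wpM2r // /e'.
rewrite -mulr_natr -mulrA ler_piMr ?ltW //.
by rewrite mulrC ltr_pdivrMr ?ltr0n // mul1r ltr_nat.
Qed.

(** The mean value theorem, applied to each coordinate of f minus its
    differential at z0 along the segment from z' to z. The sup norm makes the
    coordinatewise bounds sufficient. *)
Lemma strictly_differentiable (f : V -> V) (U : set V) (z0 : V) (e : R) :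
  open U -> U z0 -> Ck 1 U f -> 0 < e ->
  exists2 d, 0 < d & forall z z', `|z - z0| < d -> `|z' - z0| < d ->
    `|f z - f z' - 'd f z0 (z - z')| <= e * `|z - z'|.
Proof.
move=> oU Uz0 Cf e0; have [df _] := Cf.
have /nbhs_ballP[d /= d0 Hd] := diff_near oU Uz0 Cf e0.
exists d => // z z' zd z'd; pose v := z - z'.
have segm (s : R) : 0 <= s <= 1 -> ball z0 d (z' + s *: v).
  move=> /andP[s0 s1]; rewrite -ball_normE /ball_ /= distrC.
  have -> : z' + s *: v - z0 = (1 - s) *: (z' - z0) + s *: (z - z0).
    rewrite /v !scalerBr !scalerBl !scale1r; apply/rowP => j; rewrite !mxE; ring.
  apply: le_lt_trans (ler_normD _ _) _; rewrite !normrZ.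
  rewrite [`|s|]ger0_norm // [`|1 - s|]ger0_norm; last by lra.
  move: (`|z' - z0|) (`|z - z0|) z'd zd => a b ad bd.
  have : (1 - s) * a + s * b <= (1 - s) * (Num.max a b) + s * (Num.max a b).
    by apply: lerD; apply: ler_wpM2l; rewrite ?le_max ?lexx ?orbT //; lra.
  have : Num.max a b < d by rewrite gt_max ad.
  lra.
apply: rV_norm_le => [|j]; first by rewrite mulr_ge0 // ltW.
pose g (s : R) := (f (z' + s *: v)) 0 j - s * ('d f z0 v) 0 j.
pose dg (s : R) : R := ('d f (z' + s *: v) v - 'd f z0 v) 0 j.
have isg (s : R) : 0 <= s <= 1 -> is_derive s (1 : R) g (dg s).
  move=> /segm /Hd [Uz _].
  have H := is_derive_line (df _ Uz).
  have Hj : is_derive s (1 : R) (fun s => (f (z' + s *: v)) 0 j)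
      (('d f (z' + s *: v) v) 0 j).
    have dH := @ex_derive _ _ _ _ _ _ _ H.
    apply: DeriveDef; first by have /derivable_mxP := dH; apply.
    by have := derive_mx dH; rewrite (@derive_val _ _ _ _ _ _ _ H) => ->; rewrite mxE.
  have Hl : is_derive s (1 : R) (fun s : R => s * ('d f z0 v) 0 j) (('d f z0 v) 0 j).
    have -> : (fun s : R => s * ('d f z0 v) 0 j) = ('d f z0 v) 0 j \*: (@id R).
      by apply/funext => x; rewrite /= mulrC.
    rewrite -{2}[('d f z0 v) 0 j]mulr1; exact: is_deriveZ.
  rewrite /dg !mxE; exact: is_deriveB.
have [||c c01 gc] := @MVT_segment R g dg 0 1 ler01.
- by move=> s; rewrite in_itv /= => /andP[/ltW ? /ltW ?]; apply: isg; apply/andP.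
- apply: derivable_within_continuous => s; rewrite in_itv /= => s01.
  exact: (@ex_derive _ _ _ _ _ _ _ (isg s s01)).
have -> : (f z - f z' - 'd f z0 (z - z')) 0 j = dg c.
  move: gc; rewrite subr0 mulr1 => <-; rewrite /g scale1r scale0r addr0 mul0r mul1r !mxE /v.
  by rewrite subrKC subr0 addrAC.
rewrite in_itv /= in c01.
have [_ Hc] := Hd _ (segm c c01).
exact: le_trans (coord_norm_le _ _) (Hc v).
Qed.

End StrictDifferentiability.

Section LipschitzPerturbation.
Variables (R : realType) (V : completeNormedModType R).

(** To solve f z = w, iterate the contraction z |-> z - f z + w on the closed ball
    of radius 2 |w - f z0|, which it preserves. *)
Lemma lipschitz_perturbation (f : V -> V) (z0 : V) (r : R) : 0 < r ->
  (forall z z', `|z - z0| < r -> `|z' - z0| < r ->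
    `|f z - f z' - (z - z')| <= 2^-1 * `|z - z'|) ->
  exists g : V -> V, forall w, `|w - f z0| < r / 2 ->
    [/\ `|g w - z0| < r, f (g w) = w &
        forall w', `|w' - f z0| < r / 2 -> `|g w - g w'| <= 2 * `|w - w'|].
Proof.
move=> r0 lip.
have ex w : `|w - f z0| < r / 2 -> exists z, `|z - z0| < r /\ f z = w.
  move=> wr; pose rho := 2 * `|w - f z0|.
  have rhor : rho < r by rewrite /rho; lra.
  pose U := [set z : V | `|z - z0| <= rho].
  pose T := fun z => z - f z + w.
  have Tlip z z' : U z -> U z' -> `|T z - T z'| <= 2^-1 * `|z - z'|.
    move=> Uz Uz'; have := lip z z' (le_lt_trans Uz rhor) (le_lt_trans Uz' rhor).
    have -> : T z - T z' = - (f z - f z' - (z - z')); last by rewrite normrN.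
    rewrite /T opprD addrACA subrr addr0 !opprB.
    by rewrite [f z' - z']addrC [f z' - f z]addrC addrACA.
  have Uz0 : U z0 by rewrite /U /= subrr normr0 /rho mulr_ge0.
  have Tz0 : T z0 = z0 + (w - f z0) by rewrite /T -addrA [- _ + _]addrC.
  have TU : {homo T : z / U z >-> U z}.
    move=> z Uz; rewrite /U /=.
    have -> : T z - z0 = (T z - T z0) + (w - f z0).
      by rewrite Tz0; move: (w - f z0) => e; rewrite opprD addrA subrK.
    apply: le_trans (ler_normD _ _) _.
    have := Tlip _ _ Uz Uz0; move: Uz; rewrite /U /= /rho.
    move: (`|T z - T z0|) (`|z - z0|) (`|w - f z0|) => a b c; lra.
  have [|||p Up pT] := banach_fixed_point (f := mkfun TU).
  - exists (2^-1)%:nng; split => /=; first lra.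
    by move=> -[x y] [/= Ux Uy]; exact: Tlip.
  - apply: (@closed_comp _ R (fun z => `|z - z0|) [set x | x <= rho]).
      move=> z _.
      apply: (@continuous_comp _ _ _ (fun z => z - z0) (fun z => `|z|)).
        by apply: cvgB; [exact: cvg_id | exact: cvg_cst].
      exact: norm_continuous.
    exact: closed_le.
  - by exists z0.
  exists p; split; first exact: le_lt_trans Up rhor.
  have fixp : T p = p by rewrite {2}pT.
  have e : w - f p = T p - p.
    by rewrite /T [RHS]addrC addrA addKr addrC.
  by apply/esym/eqP; rewrite -subr_eq0 e fixp subrr.
have [w|g gP] := @choice V V (fun w z =>
    `|w - f z0| < r / 2 -> `|z - z0| < r /\ f z = w).
  have [wr|nwr] := pselect (`|w - f z0| < r / 2); last by exists w.
  by have [z zP] := ex w wr; exists z.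
exists g => w wr; have [gr fg] := gP w wr; split=> // w' wr'.
have [gr' fg'] := gP w' wr'.
have := lip _ _ gr gr'; rewrite fg fg'.
have := ler_normB (w - w') (w - w' - (g w - g w')); rewrite subKr distrC.
move: (`|g w - g w'|) (`|w - w'|) (`|w - w' - (g w - g w')|) => a b c; lra.
Qed.
End LipschitzPerturbation.

(** Joins the completeness of row vectors with their norm. *)
HB.instance Definition _ (R : realType) (n : nat) := Complete.on 'rV[R]_n.

(** * Linear slices *)

Section LinearSlice.
Variables (R : realType) (n : nat) (M : manifold R n) (gT : finGroupType).
Variable act : smooth_action M gT.
Local Notation V := 'rV[R]_n.

(** A slice at x with a chart phi onto a neighbourhood of 0, in which the
    stabiliser of x acts through linear maps rho. Only the ball of radius d is
    known to lie in the image of phi, and psi inverts phi over it. *)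
Record linear_slice (x : M) (U : set M) (phi : M -> V) (psi : V -> M)
    (rho : gT -> {linear V -> V}) (d C : R) : Prop := LinearSlice {
  ls_slice : slice act x U;
  ls_d : 0 < d;
  ls_C : 0 <= C;
  ls_0 : phi x = 0;
  ls_phi : forall u, U u -> {for u, continuous phi};
  ls_psi : forall w, `|w| < d -> {for w, continuous psi};
  ls_psiU : forall w, `|w| < d -> U (psi w);
  ls_psiK : forall w, `|w| < d -> phi (psi w) = w;
  ls_phiK : forall u, U u -> `|phi u| < d -> psi (phi u) = u;
  ls_rho : forall g u, g \in stab act x -> U u -> phi (act g u) = rho g (phi u);
  ls_bound : forall g w, g \in stab act x -> `|rho g w| <= C * `|w| }.

Section Averaging.
Variables (x : M) (c : chart R n M).
Hypotheses (ac : atlas c) (cx : chart_dom c x).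
Local Notation chi := (chart_map c).
Local Notation iota := (chart_inv c).
Local Notation K := (stab act x).

Lemma chart_map_cts u : chart_dom c u -> {for u, continuous chi}.
Proof.
move=> cu; have := @chart_map_continuous _ _ _ c.
rewrite continuous_open_subspace; last exact: chart_dom_open.
by apply; rewrite inE.
Qed.

Lemma chart_inv_cts w : (chi @` chart_dom c) w -> {for w, continuous iota}.
Proof.
move=> cu; have := @chart_inv_continuous _ _ _ c.
rewrite continuous_open_subspace; last exact: chart_img_open.
by apply; rewrite inE.
Qed.

Lemma chart_imageK u : chart_dom c u -> iota (chi u) = u.
Proof. by move=> cu; apply: (@chart_mapK _ _ _ c); rewrite inE. Qed.

Lemma chart_image_open (W : set M) : open W -> open (chi @` (chart_dom c `&` W)).
Proof.
move=> oW; rewrite openE => _ [u [cu Wu] <-].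
have n1 : nbhs (chi u) (chi @` chart_dom c).
  by apply: open_nbhs_nbhs; split; [exact: chart_img_open | exists u].
have n2 : \forall w \near chi u, W (iota w).
  apply: continuous_near; first by apply: chart_inv_cts; exists u.
  by rewrite chart_imageK //; exact: open_nbhs_nbhs.
rewrite /interior; apply: filterS2 n1 n2 => _ [v cv <-]; rewrite chart_imageK // => Wv.
by exists v.
Qed.

Definition action_chart (k : gT) (z : V) : V := chi (act k (iota z)).
Definition action_chart_dom (k : gT) : set V :=
  chi @` (chart_dom c `&` act k @^-1` chart_dom c).

Lemma action_chart_dom_open k : open (action_chart_dom k).
Proof.
apply: chart_image_open; apply: open_comp; last exact: chart_dom_open.
by move=> u _; exact: smact_continuous.
Qed.

Lemma action_chart_dom_center k : k \in K -> action_chart_dom k (chi x).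
Proof. by rewrite inE => /eqP kx; exists x => //; split; rewrite //= kx. Qed.

Lemma action_chart_center k : k \in K -> action_chart k (chi x) = chi x.
Proof.
by rewrite inE /action_chart => /eqP kx; rewrite chart_imageK // kx.
Qed.

Lemma action_chart_C1 k : Ck 1 (action_chart_dom k) (action_chart k).
Proof. by have [_ /(_ c c ac ac 1%N)] := smact_smooth act k. Qed.

Lemma action_chart_differentiable k : k \in K -> differentiable (action_chart k) (chi x).
Proof.
by move=> kx; have [+ _] := action_chart_C1 k; apply; exact: action_chart_dom_center.
Qed.

(** The isotropy representation on the tangent space at x, read in the chart. *)
Definition isotropy_rep (k : gT) : {linear V -> V} := 'd (action_chart k) (chi x).
Local Notation A := isotropy_rep.

Lemma isotropy_repE k v : k \in K -> A k v = 'D_v (action_chart k) (chi x).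
Proof.
by move=> kx; exact: esym (deriveE _ (action_chart_differentiable kx)).
Qed.

Lemma isotropy_rep_continuous k : k \in K -> continuous (A k).
Proof. by move=> kx; apply: diff_continuous; exact: action_chart_differentiable. Qed.

Lemma isotropy_rep_diff k z w : z = chi x ->
  'd (action_chart k) z w = A k w.
Proof. by move=> ->. Qed.

(* Unification would otherwise compare differentials by unfolding them. *)
Opaque isotropy_rep.

Lemma isotropy_repM k h v : k \in K -> h \in K -> A (k * h)%g v = A k (A h v).
Proof.
move=> kx hx; have khx : (k * h)%g \in K by exact: (groupM (G := stab_group act x)).
have dh := action_chart_differentiable hx.
have dk : differentiable (action_chart k) (action_chart h (chi x)).
  by rewrite action_chart_center //; exact: action_chart_differentiable.
have E := isotropy_repE v khx.
apply: (etrans E).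
transitivity ('D_v (action_chart k \o action_chart h) (chi x)).
  apply: near_eq_derive.
  have : nbhs (chi x) (action_chart_dom h).
    apply: open_nbhs_nbhs; split; first exact: action_chart_dom_open.
    exact: action_chart_dom_center.
  apply: filterS => _ [u [cu chu] <-].
  by rewrite /action_chart /= !chart_imageK // smactM.
have := deriveE v (differentiable_comp dh dk).
have := congr1 (fun l : V -> V => l v) (diff_comp dh dk).
rewrite /= => e1 e2; apply: (etrans e2); apply: (etrans e1).
apply: (etrans (isotropy_rep_diff k _ (action_chart_center hx))).
by congr (A k _); exact: isotropy_rep_diff.
Qed.

Lemma isotropy_rep1 v : A 1%g v = v.
Proof.
have x1 : 1%g \in K by exact: (group1 (stab_group act x)).
rewrite (isotropy_repE v x1) (@near_eq_derive _ _ _ _ id) ?derive_id //.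
have : nbhs (chi x) (action_chart_dom 1%g).
  apply: open_nbhs_nbhs; split; first exact: action_chart_dom_open.
  exact: action_chart_dom_center.
apply: filterS => _ [u [cu chu] <-].
by rewrite /action_chart /= chart_imageK // smact1.
Qed.

Lemma isotropy_repK k v : k \in K -> A k^-1%g (A k v) = v.
Proof.
move=> kx; rewrite -isotropy_repM //; last by rewrite (groupV (stab_group act x)).
by rewrite mulVg isotropy_rep1.
Qed.

Lemma isotropy_rep_bound : exists2 C, 0 < C &
  forall k v, k \in K -> `|A k v| <= C * `|v|.
Proof.
have : \forall r \near +oo, forall k, k \in K -> forall v, `|A k v| <= r * `|v|.
  apply: (@filter_forall _ gT (fun k r => k \in K -> forall v, `|A k v| <= r * `|v|)) => k.
  have [kx|_] := boolP (k \in K); last exact: nearW.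
  have /linear_boundedP : bounded_near (A k) (nbhs 0).
    by apply/linear_bounded_continuous; exact: isotropy_rep_continuous.
  by apply: filterS.
move=> near_b.
have near_p : \forall r \near +oo, (0 : R) < r by exact: nbhs_pinfty_gt.
have [C [Cb C0]] := filter_ex (filterI near_b near_p).
by exists C => // k v kx; exact: Cb.
Qed.

(** Bochner's linearisation: averaging the conjugates of the chart by the
    elements of the stabiliser makes it equivariant, and its derivative at the
    centre is still the identity. *)
Definition averaged_chart (u : M) : V :=
  #|K|%:R^-1 *: \sum_(k in K) A k^-1%g (chi (act k u) - chi x).

Lemma card_isotropy_neq0 : #|K|%:R != 0 :> R.
Proof. by rewrite pnatr_eq0 -lt0n; exact: (cardG_gt0 (stab_group act x)). Qed.

Lemma averaged_chart_center : averaged_chart x = 0.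
Proof.
rewrite /averaged_chart big1 ?scaler0 // => k; rewrite inE => /eqP ->.
by rewrite subrr linear0.
Qed.

Lemma averaged_chart_continuous u :
  (forall k, k \in K -> chart_dom c (act k u)) -> {for u, continuous averaged_chart}.
Proof.
move=> Ku; apply: cvgZr.
apply: (@cvg_big _ _ (fun a b : V => a + b)) => [|k kx]; first exact: add_continuous.
have kVx : k^-1%g \in K by rewrite (groupV (stab_group act x)).
apply: (@continuous_comp _ _ _ (fun v => chi (act k v) - chi x) (A k^-1%g)).
  apply: cvgB; last exact: cvg_cst.
  apply: (@continuous_comp _ _ _ (act k) chi); first exact: smact_continuous.
  by apply: chart_map_cts; exact: Ku.
exact: isotropy_rep_continuous.
Qed.

Lemma averaged_chart_equivariant h u : h \in K ->
  averaged_chart (act h u) = A h (averaged_chart u).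
Proof.
move=> hx; rewrite /averaged_chart [RHS]linearZ; congr (_ *: _).
rewrite [RHS]linear_sum.
have hVx : h^-1%g \in K by rewrite (groupV (stab_group act x)).
rewrite (reindex_inj (mulIg h^-1%g)) /=.
apply: eq_big => [k|k kx].
  by rewrite (groupMr (G := stab_group act x)).
have kx' : k \in K by rewrite (groupMr (G := stab_group act x)) in kx.
have -> : ((k * h^-1)^-1 = h * k^-1)%g by rewrite invMg invgK.
have -> : act (k * h^-1)%g (act h u) = act k u by rewrite -smactM mulgKV.
by apply: isotropy_repM => //; rewrite (groupV (stab_group act x)).
Qed.

(** The difference of the averaged chart and the identity is the average of the
    errors of linear approximation of the maps [action_chart k], and these have
    small Lipschitz constants near the centre. *)
Lemma averaged_chart_near_id : \forall p \near (chi x, chi x),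
  `|averaged_chart (iota p.1) - averaged_chart (iota p.2) - (p.1 - p.2)|
    <= 2^-1 * `|p.1 - p.2|.
Proof.
have [C C0 CP] := isotropy_rep_bound.
have e0 : 0 < (2 * C)^-1 by rewrite invr_gt0 mulr_gt0.
have : \forall p \near (chi x, chi x), forall k, k \in K ->
    `|action_chart k p.1 - action_chart k p.2 - A k (p.1 - p.2)|
      <= (2 * C)^-1 * `|p.1 - p.2|.
  apply: (@filter_forall _ gT (fun k p => k \in K ->
    `|action_chart k p.1 - action_chart k p.2 - A k (p.1 - p.2)|
      <= (2 * C)^-1 * `|p.1 - p.2|) (nbhs (chi x, chi x))) => k.
  have [kx|_] := boolP (k \in K); last exact: nearW.
  have [d d0 Hd] := strictly_differentiable (@action_chart_dom_open k)
    (action_chart_dom_center kx) (action_chart_C1 k) e0.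
  apply/nbhs_ballP; exists d => //= -[z z'] [/=].
  rewrite -!ball_normE /ball_ /= !(distrC (chi x)) => zd zd' _.
  exact: Hd.
apply: filterS => -[z z'] /= H.
have -> : averaged_chart (iota z) - averaged_chart (iota z') - (z - z') =
    #|K|%:R^-1 *: \sum_(k in K)
      A k^-1%g (action_chart k z - action_chart k z' - A k (z - z')).
  have mean : #|K|%:R^-1 *: \sum_(k in K) A k^-1%g (A k (z - z')) = z - z'.
    rewrite (eq_bigr (fun=> z - z')) => [|k kx]; last exact: isotropy_repK.
    rewrite sumr_const -(scaler_nat _ (z - z')) scalerA mulVf ?scale1r //.
    exact: card_isotropy_neq0.
  rewrite -[in LHS]mean /averaged_chart -!scalerBr -!sumrB; congr (_ *: _).
  apply: eq_bigr => k kx; rewrite -!linearB; congr (A _ _).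
  rewrite /action_chart; congr (_ - _).
  by rewrite opprB addrA subrK.
rewrite normrZ ger0_norm ?invr_ge0 ?ler0n //.
rewrite ler_pdivrMl ?ltr0n; last exact: (cardG_gt0 (stab_group act x)).
apply: le_trans (ler_norm_sum _ _ _) _.
apply: (@le_trans _ _ (\sum_(k in K) 2^-1 * `|z - z'|)).
  apply: ler_sum => k kx.
  apply: le_trans (CP _ _ _) _; first by rewrite (groupV (stab_group act x)).
  apply: le_trans (ler_wpM2l (ltW C0) (H k kx)) _.
  by rewrite mulrA invfM mulrCA divff ?mulr1 // gt_eqF.
by rewrite sumr_const mulr_natl.
Qed.

End Averaging.

(** By [lipschitz_perturbation] the averaged chart is a homeomorphism near x. The
    slice U is taken inside the ball where it is injective, and the radius is cut
    down until the local inverse takes values in U. *)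
Lemma linear_slice_exists (x : M) :
  exists U phi psi rho d C, linear_slice x U phi psi rho d C.
Proof.
have [c ac cx] := atlas_cover x.
pose chi := chart_map c; pose iota := chart_inv c.
pose phi := averaged_chart x c; pose F z := phi (iota z).
have [C C0 CP] := isotropy_rep_bound ac cx.
have [r0 r00 Hr0] : exists2 r, 0 < r & forall z z',
    `|z - chi x| < r -> `|z' - chi x| < r ->
    `|F z - F z' - (z - z')| <= 2^-1 * `|z - z'|.
  have /nbhs_ballP[r /= rp Hr] := averaged_chart_near_id ac cx.
  exists r => // z z' zr zr'; apply: (Hr (z, z')).
  by split; rewrite -ball_normE /ball_ /= distrC.
have [r1 r10 Hr1] : exists2 r, 0 < r &
    forall z, `|z - chi x| < r -> (chi @` chart_dom c) z.
  have : nbhs (chi x) (chi @` chart_dom c).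
    by apply: open_nbhs_nbhs; split; [exact: chart_img_open | exists x].
  move=> /nbhs_ballP[r /= rp Hr]; exists r => // z zr; apply: Hr.
  by rewrite -ball_normE /ball_ /= distrC.
pose r := Num.min r0 r1.
have [rr0 rr1] := min_le r0 r1.
have rp : 0 < r by exact: min_gt0.
have lipF z z' : `|z - chi x| < r -> `|z' - chi x| < r ->
    `|F z - F z' - (z - z')| <= 2^-1 * `|z - z'|.
  by move=> zr zr'; apply: Hr0; [exact: lt_le_trans zr rr0 | exact: lt_le_trans zr' rr0].
have imr z : `|z - chi x| < r -> (chi @` chart_dom c) z.
  by move=> zr; apply: Hr1; exact: lt_le_trans zr rr1.
have injF z z' : `|z - chi x| < r -> `|z' - chi x| < r -> F z = F z' -> z = z'.
  move=> zr zr' e; have := lipF _ _ zr zr'; rewrite e subrr sub0r normrN => le2.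
  apply/eqP; rewrite -subr_eq0 -normr_le0; lra.
have F0 : F (chi x) = 0 by rewrite /F /iota chart_imageK // /phi averaged_chart_center.
have [g gP] := lipschitz_perturbation rp lipF.
rewrite F0 in gP.
have r2 : 0 < r / 2 by lra.
have g0 : g 0 = chi x.
  have [|gr fg _] := gP 0; first by rewrite subr0 normr0.
  by apply: injF; rewrite ?subrr ?normr0 // fg F0.
pose psi w := iota (g w).
have g_cts (w : V) : `|w| < r / 2 -> {for w, continuous g}.
  move=> wr N /nbhs_ballP[e /= e0 Ne].
  have [m1 m2] := min_le (e / 2) (r / 2 - `|w|).
  apply/nbhs_ballP; exists (Num.min (e / 2) (r / 2 - `|w|)) => /=.
    by apply: min_gt0; lra.
  move=> w'; rewrite -ball_normE /ball_ /= => ww'; apply: Ne.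
  have [|_ _ /(_ w')] := gP w; first by rewrite subr0.
  have w'r : `|w'| < r / 2.
    by have := ler_normB w (w - w'); rewrite subKr; lra.
  by rewrite subr0 -ball_normE /ball_ /= => /(_ w'r); lra.
have psi_cts (w : V) : `|w| < r / 2 -> {for w, continuous psi}.
  move=> wr; apply: continuous_comp; first exact: g_cts.
  apply: chart_inv_cts; apply: imr.
  by have [] := gP w; rewrite ?subr0.
pose B := chart_dom c `&` [set u | `|chi u - chi x| < r].
have nB : nbhs x B.
  apply: filterI; first by apply: open_nbhs_nbhs; split=> //; exact: chart_dom_open.
  apply: (continuous_near (N := [set z | `|z - chi x| < r]) (chart_map_cts cx)).
  apply/nbhs_ballP; exists r => //= z.
  by rewrite -ball_normE /ball_ /= distrC.
have [U sU UB] := slice_exists act nB.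
have [oU Ux inv _] := sU.
have nU : nbhs (psi 0) U.
  by rewrite /psi g0 /iota chart_imageK //; exact: open_nbhs_nbhs.
have [d0 d00 Hd0] : exists2 d, 0 < d & forall w, `|w| < d -> U (psi w).
  have : \forall w \near (0 : V), U (psi w).
    by apply: continuous_near nU; apply: psi_cts; rewrite normr0.
  move=> /nbhs_ballP[d /= dp Hd]; exists d => // w wd; apply: Hd.
  by rewrite -ball_normE /ball_ /= sub0r normrN.
have [dd0 dr] := min_le d0 (r / 2).
exists U, phi, psi, (isotropy_rep x c), (Num.min d0 (r / 2)), C; split.
- exact: sU.
- exact: min_gt0.
- exact: ltW.
- exact: averaged_chart_center.
- move=> u Uu; apply: averaged_chart_continuous => // k kx.
  by have [] := UB _ (inv _ _ kx Uu).
- by move=> w wd; apply: psi_cts; exact: lt_le_trans wd dr.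
- by move=> w wd; apply: Hd0; exact: lt_le_trans wd dd0.
- move=> w wd; have [|_ + _] := gP w; last by [].
  by rewrite subr0; exact: lt_le_trans wd dr.
- move=> u Uu ud; have [cu ur] := UB _ Uu.
  have [|gr fg _] := gP (phi u); first by rewrite subr0; exact: lt_le_trans ud dr.
  rewrite /psi (injF _ _ gr ur) ?fg /F /iota ?chart_imageK //.
- by move=> h u hx _; exact: (averaged_chart_equivariant ac cx u hx).
- by move=> h w hx; exact: CP.
Qed.

End LinearSlice.

(** * Pushing a path off its singular strata *)

Section PushOff.
Variables (R : realType) (n : nat) (M : manifold R n) (gT : finGroupType).
Variable act : smooth_action M gT.
Local Notation V := 'rV[R]_n.

Section InLinearSlice.
Variables (x : M) (U : set M) (phi : M -> V) (psi : V -> M).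
Variables (rho : gT -> {linear V -> V}) (d C : R).
Hypothesis ls : linear_slice act x U phi psi rho d C.

Lemma linear_slice_continuous g : g \in stab act x -> continuous (rho g).
Proof.
move=> gx; apply/linear_bounded_continuous/linear_boundedP.
have : \forall s \near +oo, C <= s by apply: nbhs_pinfty_ge; exact: num_real.
apply: filterS => s Cs v; apply: le_trans (ls_bound ls v gx) _.
exact: ler_wpM2r.
Qed.

Lemma linear_slice_stab g u : U u -> `|phi u| < d -> g \in stab act x ->
  (g \in stab act u) = (rho g (phi u) == phi u).
Proof.
move=> Uu ud gx; rewrite inE; apply/eqP/eqP => [gu|e].
  by rewrite -(ls_rho ls gx Uu) gu.
have [_ _ inv _] := ls_slice ls.
by rewrite -(ls_phiK ls (inv _ _ gx Uu)) (ls_rho ls gx Uu) e ?(ls_phiK ls).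
Qed.

(** If g fixes u, then g fixes phi u + v exactly when it fixes v. Otherwise g
    moves phi u by more than the change that v can bring about. *)
Lemma stab_push (u : M) (v : V) (H : {set gT}) :
  U u -> `|phi u| < d -> `|phi u + v| < d -> H \subset stab act u ->
  (forall g, g \in stab act u -> (rho g v == v) = (g \in H)) ->
  (forall g, g \in stab act x -> g \notin stab act u ->
    `|rho g v - v| < `|rho g (phi u) - phi u|) ->
  stab act (psi (phi u + v)) = H.
Proof.
move=> Uu ud vd Hu Hv far; have Upsi := ls_psiU ls vd.
have sub := slice_stab (ls_slice ls) Upsi.
have subu := slice_stab (ls_slice ls) Uu.
apply/setP => g; have [gx|gx] := boolP (g \in stab act x); last first.
  rewrite (negbTE (contra (fintype.subsetP sub g) gx)).
  have gu := contra (fintype.subsetP subu g) gx.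
  by rewrite (negbTE (contra (fintype.subsetP Hu g) gu)).
rewrite linear_slice_stab // (ls_psiK ls vd) // linearD.
have [gu|gu] := boolP (g \in stab act u).
  have /eqP -> : rho g (phi u) == phi u by rewrite -linear_slice_stab.
  by rewrite (inj_eq (addrI _)) Hv.
rewrite (negbTE (contra (fintype.subsetP Hu g) gu)); apply/negbTE/negP => /eqP e.
have := far g gx gu.
have -> : rho g v - v = - (rho g (phi u) - phi u).
  apply/eqP; rewrite -addr_eq0 addrACA [rho g v + _]addrC e -opprD.
  by rewrite [v + _]addrC subrr.
by rewrite normrN ltxx.
Qed.

End InLinearSlice.

Definition pushable (c : R -> M) (t : R) : Prop :=
  exists e : R * R -> M, [/\ continuous e,
    forall r, t <= r <= 1 -> e (r, 0) = c r &
    forall r a, t <= r <= 1 -> 0 < a <= 1 -> stab act (e (r, a)) = stab act (c 1)].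

(** Push-off is allowed to fail at the left endpoint: advancing along the path
    while pushing leaves the bad line r = t as soon as a > 0. *)
Lemma pushable_left (c : R -> M) (t : R) (e : R * R -> M) : t < 1 -> continuous e ->
  (forall r, t <= r <= 1 -> e (r, 0) = c r) ->
  (forall r a, t < r <= 1 -> 0 < a <= 1 -> stab act (e (r, a)) = stab act (c 1)) ->
  pushable c t.
Proof.
move=> t1 ce e0 es; exists (fun z => e (z.1 + z.2 * (1 - z.1), z.2)); split.
- move=> z; apply: (@continuous_comp _ _ _ (fun z : R * R => (z.1 + z.2 * (1 - z.1), z.2)) e);
    last exact: ce.
  apply: continuous_pair; last exact: cvg_snd.
  apply: cvgD; first exact: cvg_fst.
  apply: cvgM; first exact: cvg_snd.
  by apply: cvgB; [exact: cvg_cst | exact: cvg_fst].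
- by move=> r rt; rewrite /= mul0r addr0 e0.
- move=> r a /andP[tr r1] /andP[a0 a1] /=; apply: es; last by apply/andP.
  have h1 : 0 <= a * (1 - r) by apply: mulr_ge0; lra.
  have h2 : a * (1 - r) <= 1 - r by rewrite ler_piMl //; lra.
  apply/andP; split; last by lra.
  move: h1; rewrite le_eqVlt => /orP[/eqP h|]; last by lra.
  have : (1 - r) == 0 by move: h => /esym/eqP; rewrite mulf_eq0 gt_eqF.
  by move=> /eqP; lra.
Qed.

Lemma continuous_bigmin (I : finType) (P : pred I) (f : I -> R -> R) :
  (forall i, P i -> continuous (f i)) ->
  continuous (fun r => \big[Num.min/1]_(i | P i) f i r).
Proof.
move=> cf; apply: (@continuous_big _ _ (fun a b : R => Num.min a b)) => // z.
exact: (@continuous_min R (R * R)%type (@fst R R) (@snd R R) z cvg_fst cvg_snd).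
Qed.

(** In the linear slice, the displacements W s = phi (e (b, s)) - phi (c b) are
    carried to the other points of the path, scaled by eta. Here p r bounds from
    below how far the elements outside K move the point of the path at time r,
    and eta r is at most p r / p b. *)
Lemma pushable_step (c : R -> M) x U phi psi rho d C (a b : R) (K : {set gT}) :
  linear_slice act x U phi psi rho d C ->
  continuous c -> (forall s t, s <= t -> stab act (c t) \subset stab act (c s)) ->
  a < b -> b <= 1 -> (forall r, a <= r <= b -> U (c r) /\ `|phi (c r)| < d / 2) ->
  (forall r, a < r <= b -> stab act (c r) = K) -> pushable c b -> pushable c a.
Proof.
move=> ls cc mono ab b1 cU cK [e [ce e0 es]].
have [oU Ux inv sep] := ls_slice ls.
have d0 := ls_d ls; have C0 := ls_C ls.
have bb : a <= b <= b by apply/andP; split; lra.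
have ab' : a < b <= b by apply/andP; split; lra.
have b11 : b <= b <= 1 by apply/andP; split; lra.
have cl_in r : a <= clamp a b r <= b by apply: clamp_itv; exact: ltW.
pose q r := phi (c (clamp a b r)).
have qd r : `|q r| < d / 2 by have [_] := cU _ (cl_in r).
have cq : continuous q.
  move=> r; apply: (@continuous_comp _ _ _ (c \o clamp a b) phi).
    by apply: continuous_comp; [exact: clamp_continuous | exact: cc].
  by apply: (ls_phi ls); have [] := cU _ (cl_in r).
pose D g r := `|rho g (q r) - q r|.
have cD g : g \in stab act x -> continuous (D g).
  move=> gx r; apply: (@continuous_comp _ _ _ (fun r => rho g (q r) - q r) (fun v => `|v|));
    last exact: norm_continuous.
  apply: cvgB; last exact: cq.
  apply: (@continuous_comp _ _ _ q (rho g)); first exact: cq.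
  exact: (linear_slice_continuous ls gx).
pose p r := \big[Num.min/1]_(g | (g \in stab act x) && (g \notin K)) D g r.
have cp : continuous p by apply: continuous_bigmin => g /andP[/cD].
have pD g r : g \in stab act x -> g \notin K -> p r <= D g r.
  by move=> gx gK; apply: bigmin_le_cond; rewrite gx.
have p0 r : a < r <= b -> 0 < p r.
  move=> /[dup] rab /andP[ar rb]; apply: lt_bigmin => // g /andP[gx gK].
  rewrite /D normr_gt0 subr_eq0 /q clamp_id ?(ltW ar) //.
  have [|Ur rd] := cU r; first by rewrite (ltW ar).
  rewrite -(linear_slice_stab ls) ?cK //; lra.
have pge0 r : 0 <= p r.
  rewrite /p; elim/big_ind: _ => [|u v u0 v0|g _]; first exact: ler01.
    by rewrite le_min u0.
  exact: normr_ge0.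
have pb := p0 b ab'.
pose eta r := Num.min 1 (p r / p b).
have ceta : continuous eta.
  move=> r; apply: (@continuous_min _ R (cst 1) (fun r => p r / p b)); first exact: cvg_cst.
  by apply: cvgM; [exact: cp | exact: cvg_cst].
have eta1 r : eta r <= 1 by have [] := min_le 1 (p r / p b).
have eta_p r : eta r * p b <= p r.
  by rewrite -ler_pdivlMr //; have [] := min_le 1 (p r / p b).
have eta_ge0 r : 0 <= eta r by rewrite le_min ler01 divr_ge0 // ltW.
have eta_gt0 r : a < r <= b -> 0 < eta r.
  by move=> rab; rewrite lt_min ltr01 divr_gt0 ?p0.
have etab : eta b = 1 by rewrite /eta divff ?minxx // gt_eqF.
have Ucb : U (c b) by have [] := cU b bb.
have eb0 : e (b, 0) = c b by rewrite e0.
have C10 : 0 < C + 1 by lra.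
(* Displacements below m stay in the ball, and no rho g - 1 stretches them
   beyond p b, its norm being at most C + 1. *)
pose m := Num.min (d / 2) (p b / (C + 1)).
have m0 : 0 < m by apply: min_gt0; [lra | exact: divr_gt0].
have [m1 m2] := min_le (d / 2) (p b / (C + 1)).
have ceb : continuous (fun s : R => e (b, s)).
  move=> s; apply: (@continuous_comp _ _ _ (fun s : R => (b, s)) e); last exact: ce.
  by apply: continuous_pair; [exact: cvg_cst | exact: cvg_id].
have [t0 [t00 t01 small]] : exists t0, [/\ 0 < t0, t0 <= 1 &
    forall s, 0 <= s <= t0 -> U (e (b, s)) /\ `|phi (e (b, s)) - phi (c b)| < m].
  have n1 : \forall s \near 0, U (e (b, s)).
    apply: (continuous_near (ceb 0)); rewrite eb0; exact: open_nbhs_nbhs.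
  have n2 : \forall s \near 0, `|phi (e (b, s)) - phi (c b)| < m.
    have cphi : {for (0 : R), continuous (fun s => phi (e (b, s)))}.
      apply: (@continuous_comp _ _ _ (fun s => e (b, s)) phi); first exact: ceb.
      by rewrite eb0; apply: (ls_phi ls).
    apply: (continuous_near (N := [set v | `|v - phi (c b)| < m]) cphi).
    rewrite eb0; apply/nbhs_ballP; exists m => //= v.
    by rewrite -ball_normE /ball_ /= distrC.
  have [s s0 Hs] := near_itv (filterI n1 n2).
  have [m3 m4] := min_le 1 (s / 2).
  exists (Num.min 1 (s / 2)); split=> //; first by apply: min_gt0; lra.
  by move=> t /andP[ta tb]; apply: Hs; lra.
pose sc s := t0 * clamp 0 1 s.
have sc_in s : 0 <= sc s <= t0.
  have /andP[h1 h2] := @clamp_itv R 0 1 s ler01.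
  rewrite /sc; apply/andP; split; first by apply: mulr_ge0 => //; exact: ltW.
  by rewrite -[leRHS]mulr1; apply: ler_wpM2l => //; exact: ltW.
have sc0 : sc 0 = 0 by rewrite /sc clamp_id ?mulr0 // lexx ler01.
have sc_gt0 s : 0 < s <= 1 -> 0 < sc s.
  by move=> /andP[s0 s1]; rewrite /sc clamp_id ?s1 ?(ltW s0) // mulr_gt0.
have csc : continuous sc.
  by move=> s; apply: cvgM; [exact: cvg_cst | exact: clamp_continuous].
pose W s := phi (e (b, sc s)) - phi (c b).
have WU s : U (e (b, sc s)) by have [] := small _ (sc_in s).
have Wm s : `|W s| < m by have [] := small _ (sc_in s).
have cW : continuous W.
  move=> s; apply: cvgB; last exact: cvg_cst.
  apply: (@continuous_comp _ _ _ (fun s => e (b, sc s)) phi); last exact: (ls_phi ls).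
  by apply: (@continuous_comp _ _ _ sc (fun s => e (b, s))); [exact: csc | exact: ceb].
have Wb s : phi (c b) + W s = phi (e (b, sc s)) by rewrite /W subrKC.
have Wd s : `|phi (e (b, sc s))| < d.
  rewrite -Wb; apply: le_lt_trans (ler_normD _ _) _.
  have [_ h1] := cU b bb; have := Wm s; move: h1 m1; rewrite -/m; lra.
pose z (y : R * R) := q y.1 + eta y.1 *: W y.2.
have zd y : `|z y| < d.
  apply: le_lt_trans (ler_normD _ _) _; rewrite normrZ ger0_norm //.
  have h1 : eta y.1 * `|W y.2| <= `|W y.2| by rewrite ler_piMl.
  have h2 := Wm y.2; have h3 := qd y.1; move: m1; rewrite -/m; lra.
have cz : continuous z.
  move=> y; apply: cvgD.
    by apply: (@continuous_comp _ _ _ fst q); [exact: cvg_fst | exact: cq].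
  apply: cvgZ.
    by apply: (@continuous_comp _ _ _ fst eta); [exact: cvg_fst | exact: ceta].
  by apply: (@continuous_comp _ _ _ snd W); [exact: cvg_snd | exact: cW].
pose e1 (y : R * R) := if y.1 <= b then psi (z y) else e (y.1, sc y.2).
apply: (@pushable_left c a e1); first lra.
- apply: (@glue_continuous R _ _ fst b (fun y => psi (z y)) (fun y => e (y.1, sc y.2))).
  + by move=> y; exact: cvg_fst.
  + move=> y; apply: (@continuous_comp _ _ _ z psi); first exact: cz.
    exact: (ls_psi ls).
  + move=> y; apply: (@continuous_comp _ _ _ (fun y => (y.1, sc y.2)) e); last exact: ce.
    apply: continuous_pair; first exact: cvg_fst.
    by apply: (@continuous_comp _ _ _ snd sc); [exact: cvg_snd | exact: csc].
  + move=> [r s] /= ->; rewrite /z /= etab scale1r /q clamp_id // Wb.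
    by apply: (ls_phiK ls).
- move=> r /andP[ar r1]; rewrite /e1 /=; have [rb|br] := leP r b; last first.
    by rewrite sc0 e0 // (ltW br).
  rewrite /z /= /W sc0 eb0 subrr scaler0 addr0 /q clamp_id ?ar //.
  have [|Ur rd] := cU r; first by rewrite ar.
  apply: (ls_phiK ls) => //; lra.
- move=> r s /andP[ar r1] s01; rewrite /e1 /=; have [rb|br] := leP r b; last first.
    apply: es; first by rewrite (ltW br).
    rewrite sc_gt0 //=; have /andP[_ h] := sc_in s; exact: le_trans h t01.
  have rab : a < r <= b by rewrite ar.
  have [|Ur rd] := cU r; first by rewrite (ltW ar).
  have sK := cK r rab; have sbK := cK b ab'.
  rewrite /z /= /q clamp_id ?(ltW ar) //.
  apply: (stab_push ls) => //.
  + lra.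
  + by have := zd (r, s); rewrite /z /q /= clamp_id // (ltW ar).
  + exact: mono.
  + move=> g; rewrite sK => gK.
    have gb : g \in stab act (c b) by rewrite sbK.
    have gx := fintype.subsetP (slice_stab (ls_slice ls) Ucb) g gb.
    rewrite linearZ /= (inj_eq (scalerI _)); last by rewrite gt_eqF // eta_gt0.
    have stab_e : stab act (e (b, sc s)) = stab act (c 1).
      apply: es => //; rewrite sc_gt0 //=; have /andP[_ h] := sc_in s; exact: le_trans h t01.
    rewrite -stab_e (linear_slice_stab ls) // /W linearB.
    have [_ bd] := cU b bb.
    have /eqP -> : rho g (phi (c b)) == phi (c b) by rewrite -(linear_slice_stab ls) //; lra.
    by rewrite (inj_eq (addIr _)).
  + move=> g gx; rewrite sK => gK.
    rewrite linearZ /= -scalerBr normrZ ger0_norm //.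
    have h1 : `|rho g (W s) - W s| <= (C + 1) * `|W s|.
      apply: le_trans (ler_normB _ _) _; rewrite mulrDl mul1r lerD2r.
      exact: (ls_bound ls).
    have h2 : (C + 1) * `|W s| < p b.
      rewrite mulrC -ltr_pdivlMr //; exact: lt_le_trans (Wm s) m2.
    have h3 : eta r * `|rho g (W s) - W s| < eta r * p b.
      by rewrite ltr_pM2l ?eta_gt0 //; exact: le_lt_trans h1 h2.
    apply: lt_le_trans h3 (le_trans (eta_p r) _).
    by have := pD g r gx gK; rewrite /D /q clamp_id // (ltW ar).
Qed.

(** A decreasing family of subgroups of a finite group is constant just after t:
    take b where the cardinal is maximal. *)
Lemma stab_eventually_constant (c : R -> M) (t e : R) : 0 < e ->
  (forall s t, s <= t -> stab act (c t) \subset stab act (c s)) ->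
  exists2 b, t < b < t + e & forall r, t < r <= b -> stab act (c r) = stab act (c b).
Proof.
move=> e0 mono.
pose Q k := `[< exists2 b, t < b < t + e & #|stab act (c b)| = k >].
have exQ : exists k, Q k.
  by exists #|stab act (c (t + e / 2))|; apply/asboolP; exists (t + e / 2) => //;
    apply/andP; split; lra.
have bQ k : Q k -> (k <= #|gT|)%N by move=> /asboolP[b _ <-]; exact: max_card.
case: (ex_maxnP exQ bQ) => k /asboolP[b /andP[tb be] <-] kmax.
exists b; first by rewrite tb.
move=> r /andP[tr rb]; apply/esym/eqP; rewrite eqEcard mono //=.
by apply: kmax; apply/asboolP; exists r => //; apply/andP; split; lra.
Qed.

(** Both steps of the backward induction are instances of [pushable_step], with
    the slice centred at c t: to the left of t the stabiliser is that of c t, and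
    immediately to the right of t it is constant, though possibly smaller. *)
Lemma path_pushable (c : R -> M) : continuous c ->
  (forall s t, s <= t -> stab act (c t) \subset stab act (c s)) -> pushable c 0.
Proof.
move=> cc mono.
have near_slice t : exists U phi psi rho d C, linear_slice act (c t) U phi psi rho d C /\
    exists2 e, 0 < e & forall r, t - e < r -> r < t + e ->
      U (c r) /\ `|phi (c r)| < d / 2.
  have [U [phi [psi [rho [d [C ls]]]]]] := linear_slice_exists act (c t).
  exists U, phi, psi, rho, d, C; split=> //.
  have [oU Ux _ _] := ls_slice ls.
  have d20 : 0 < d / 2 by have := ls_d ls; lra.
  apply: near_itv; apply: filterI.
    by apply: (continuous_near (cc t)); exact: open_nbhs_nbhs.
  have cphi : {for t, continuous (phi \o c)}.
    by apply: continuous_comp; [exact: cc | exact: (ls_phi ls)].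
  apply: (continuous_near (N := [set v | `|v| < d / 2]) cphi).
  rewrite /= (ls_0 ls); apply/nbhs_ballP; exists (d / 2) => //= v.
  by rewrite -ball_normE /ball_ /= sub0r normrN.
apply: (@real_ind_down R 1 (pushable c)) => //.
- move=> t t1 IH; have [tlt|] := ltP t 1; last first.
    move=> t1'; exists (fun _ => c 1); split=> //; first by move=> ?; exact: cvg_cst.
    by move=> r /andP[tr r1]; have -> : r = 1 by lra.
  have [U [phi [psi [rho [d [C [ls [e e0 He]]]]]]]] := near_slice t.
  have [u [tu u1 ue]] := right_of tlt e0.
  have ut0 : 0 < u - t by lra.
  have [b /andP[tb bu] bK] := stab_eventually_constant t ut0 mono.
  apply: (pushable_step (K := stab act (c b)) ls cc mono tb).
  + lra.
  + by move=> r /andP[tr rb]; apply: He; lra.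
  + exact: bK.
  + by apply: IH => //; lra.
- move=> t t1 Pt.
  have [U [phi [psi [rho [d [C [ls [e e0 He]]]]]]]] := near_slice t.
  exists e => // u ue ut.
  apply: (pushable_step (K := stab act (c t)) ls cc mono ut) => //.
  + by move=> r /andP[tr rb]; apply: He; lra.
  + move=> r /andP[ur rt]; apply/eqP; rewrite finset.eqEsubset (mono r t) // andbT.
    apply: (slice_stab (ls_slice ls)); have [] := He r => //; lra.
Qed.

End PushOff.

(** * Exit path homotopies in the orbit space *)

Section ExitPathHomotopies.
Variables (R : realType) (n : nat) (M : manifold R n) (gT : finGroupType).
Variable act : smooth_action M gT.
Local Notation S := (orbit_strat act).
Local Notation pi := (orbit_pi act).

Lemma unitIE (t : R) : unitI t = (0 <= t <= 1) :> Prop.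
Proof. by rewrite /unitI /= in_itv. Qed.

Lemma unitI_clamp (t : R) : unitI (clamp 0 1 t).
Proof. by rewrite unitIE; apply: clamp_itv; exact: ler01. Qed.

(** The amount of push a t (1 - t) vanishes at both ends of the path; for a > 0
    it is positive in between, so that only the starting point keeps a larger
    stabiliser. *)
Lemma push_homotopy (c : R -> M) : continuous c ->
  (forall s t, s <= t -> stab act (c t) \subset stab act (c s)) ->
  exists F : R * R -> M, [/\ continuous F,
    forall t, 0 <= t <= 1 -> F (t, 0) = c t,
    forall a, F (0, a) = c 0 /\ F (1, a) = c 1,
    forall s t a, 0 <= s -> s <= t -> t <= 1 -> 0 <= a <= 1 ->
      stab act (F (t, a)) \subset stab act (F (s, a)) &
    forall t, 0 < t <= 1 -> stab act (F (t, 1)) = stab act (c 1)].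
Proof.
move=> cc mono; have [e [ce e0 es]] := path_pushable cc mono.
pose tau (t a : R) := a * (t * (1 - t)).
exists (fun z => e (z.1, tau z.1 z.2)).
have tau_ge0 t a : 0 <= t <= 1 -> 0 <= a <= 1 -> 0 <= tau t a <= 1.
  move=> /andP[t0 t1] /andP[a0 a1].
  have u0 : 0 <= t * (1 - t) by apply: mulr_ge0; lra.
  have u1 : t * (1 - t) <= 1.
    by rewrite -[leRHS]mulr1; apply: ler_pM; lra.
  apply/andP; split; first exact: mulr_ge0.
  by rewrite -[leRHS]mulr1; apply: ler_pM.
have e_c1 t : 0 <= t <= 1 -> stab act (c 1) \subset stab act (c t).
  by move=> /andP[_ t1]; exact: mono.
have stabF t a : 0 <= t <= 1 -> 0 <= a <= 1 ->
    stab act (c 1) \subset stab act (e (t, tau t a)).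
  move=> tI aI; have /andP[] := tau_ge0 t a tI aI; rewrite le_eqVlt.
  move=> /orP[/eqP <- _|t0 t1]; first by rewrite e0 // e_c1.
  by rewrite es ?t0.
have tau0 a : tau 0 a = 0 by rewrite /tau mul0r mulr0.
have tau1 a : tau 1 a = 0 by rewrite /tau subrr !mulr0.
have in0 : 0 <= (0 : R) <= 1 by rewrite lexx ler01.
have in1 : 0 <= (1 : R) <= 1 by rewrite lexx ler01.
split.
- move=> z; apply: (@continuous_comp _ _ _ (fun z : R * R => (z.1, tau z.1 z.2)) e);
    last exact: ce.
  apply: continuous_pair; first exact: cvg_fst.
  apply: cvgM; first exact: cvg_snd.
  apply: cvgM; first exact: cvg_fst.
  by apply: cvgB; [exact: cvg_cst | exact: cvg_fst].
- by move=> t tI; rewrite /= /tau mul0r e0.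
- by move=> a /=; rewrite tau0 tau1 !e0.
- move=> s t a s0 st t1 aI /=.
  have tI : 0 <= t <= 1 by apply/andP; split; lra.
  have sI : 0 <= s <= 1 by apply/andP; split; lra.
  have /andP[] := tau_ge0 t a tI aI; rewrite le_eqVlt => /orP[/eqP tau_t0 _|t0 t1'].
    have /or3P[/eqP a0|/eqP t0|] : [|| a == 0, t == 0 | 1 - t == 0].
      by rewrite -!mulf_eq0 -/(tau t a) -tau_t0.
    + by rewrite a0 /tau !mul0r !e0 // mono.
    + by have -> : s = t by lra.
    + rewrite subr_eq0 => /eqP t1e; rewrite -t1e tau1 e0 //; exact: stabF.
  by rewrite (es t) ?t0 //; exact: stabF.
- move=> t /andP[t0 t1] /=.
  have tI : 0 <= t <= 1 by rewrite (ltW t0).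
  have [t1e|tn1] := eqVneq t 1; first by rewrite t1e tau1 e0.
  have /andP[h1 h2] := tau_ge0 t 1 tI in1.
  apply: es => //; rewrite h2 andbT /tau mul1r mulr_gt0 //.
  by rewrite subr_gt0 lt_neqAle tn1.
Qed.

Lemma exit_path_push (f : R -> orbit_space act) : exit_path S f ->
  exists F : R * R -> M, [/\ continuous F,
    immediately_exiting_path S (fun t => pi (F (t, 1))) &
    exit_path_homotopy_between S f (fun t => pi (F (t, 1))) (pi \o F)].
Proof.
move=> [cf mono]; pose fc := f \o clamp 0 1.
have cfc : continuous fc.
  apply: (within_continuous_comp cf) => [|t]; first exact: clamp_continuous.
  exact: unitI_clamp.
have monoc s t : s <= t -> (S (fc s) <= S (fc t))%O.
  by move=> st; apply: mono; [exact: unitI_clamp | exact: unitI_clamp | exact: clamp_mono].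
have clI (t : R) : unitI t -> clamp 0 1 t = t by rewrite unitIE; exact: clamp_id.
have in0 : unitI (0 : R) by rewrite unitIE lexx ler01.
have in1 : unitI (1 : R) by rewrite unitIE lexx ler01.
have pi_surj : pi (repr (f 1)) = f 1 by exact: reprK.
have [l [cl pl l1]] : exists l : R -> M, [/\ continuous l,
    forall r, pi (l r) = fc r & l 1 = repr (f 1)].
  apply: exit_path_lift => //.
  - by move=> r r0; rewrite /fc /= (clamp_le ler01 r0) (clamp_le ler01 (lexx 0)).
  - by move=> r r1; rewrite pi_surj /fc /= (clamp_ge ler01 r1).
have mono_l : forall s t, s <= t -> stab act (l t) \subset stab act (l s).
  by apply: lift_stab_mono => // s t st; rewrite !pl; exact: monoc.
have [F [cF F0 Fe Fs F1]] := push_homotopy cl mono_l.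
have plI t : unitI t -> pi (l t) = f t by move=> tI; rewrite pl /fc /= clI.
have exitF a : unitI a -> exit_path S (fun t => pi (F (t, a))).
  move=> aI; split.
    apply: continuous_subspaceT => t.
    apply: (@continuous_comp _ _ _ (fun t : R => (t, a)) (pi \o F)).
      by apply: continuous_pair; [exact: cvg_id | exact: cvg_cst].
    by apply: continuous_comp; [exact: cF | exact: orbit_pi_continuous].
  move=> s t; rewrite !unitIE => /andP[s0 s1] /andP[t0 t1] st.
  by rewrite !orbit_stratE; apply: stab_type_sub; apply: Fs => //; rewrite unitIE in aI.
exists F; split=> //.
- split; first exact: exitF.
  exists (S (f 0)), (S (f 1)); split.
  + by apply: mono => //; exact: ler01.
  + by rewrite (Fe 1).1 plI.
  + move=> t; rewrite unitIE => /andP[_ t1] t0.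
    rewrite -(plI 1 in1) !orbit_stratE; apply: stab_type_eq; apply: F1.
    by rewrite t0.
- split.
  + apply: continuous_subspaceT => z.
    by apply: continuous_comp; [exact: cF | exact: orbit_pi_continuous].
  + by move=> t tI; rewrite /= F0 -?unitIE // plI.
  + by move=> a aI; rewrite /= (Fe a).1 (Fe a).2 !plI.
  + exact: exitF.
Qed.

(** Transfers [exit_homotopy_lift] to maps that are controlled on the unit square
    only. *)
Lemma exit_path_homotopy_lift (K : R * R -> orbit_space act) (y : M) :
  exit_path_homotopy S K -> pi y = K (1, 0) ->
  exists L, lift_along pi K L /\ L (1, 0) = y.
Proof.
move=> [cK _ Ke Kexit] py.
pose cl2 (z : R * R) := (clamp 0 1 z.1, clamp 0 1 z.2).
have cl2_cts : continuous cl2.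
  move=> z; apply: (@continuous_pair _ _ _ (fun z : R * R => clamp 0 1 z.1)
    (fun z : R * R => clamp 0 1 z.2)).
    by apply: (@continuous_comp _ _ _ fst (clamp 0 1)); [exact: cvg_fst | exact: clamp_continuous].
  by apply: (@continuous_comp _ _ _ snd (clamp 0 1)); [exact: cvg_snd | exact: clamp_continuous].
have cl2_in z : (unitI `*` unitI) (cl2 z) by split; exact: unitI_clamp.
have [L [cL pL L1]] : exists L : R * R -> M,
    [/\ forall t v, t <= 1 -> {for (t, v), continuous L},
    forall z, pi (L z) = K (cl2 z) & forall v, L (1, v) = y].
  apply: exit_homotopy_lift => //.
  - exact: (within_continuous_comp cK).
  - move=> v s t st; have [_ mono] := Kexit _ (unitI_clamp v).
    by apply: mono; [exact: unitI_clamp | exact: unitI_clamp | exact: clamp_mono].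
  - move=> v r r0; rewrite /cl2 /=.
    by rewrite (clamp_le ler01 r0) (clamp_le ler01 (lexx 0)).
  - move=> v r r1; rewrite /cl2 py /= (clamp_ge ler01 r1).
    by have [_ ->] := Ke _ (unitI_clamp v).
exists L; split=> //; split.
- apply/subspace_continuousP => -[t v] [/= tI vI] N NL.
  have t1 : t <= 1 by move: tI; rewrite unitIE => /andP[].
  have := continuous_near (cL t v t1) NL.
  by apply: filterS => z Nz _.
- move=> [t v] [/= tI vI]; rewrite pL /cl2 /=.
  by rewrite !clamp_id // -unitIE.
Qed.

(** For a up to 1/2 the parameter s is shrunk to 0, and then the path H (., 0) is
    pushed off. The endpoints never move, since H is constant on the sides t = 0
    and t = 1. *)
Lemma exit_homotopy_contract (H : R * R -> orbit_space act) : exit_path_homotopy S H ->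
  exists (H' : R * R -> orbit_space act) (Phi : R * R * R -> orbit_space act),
      immediately_exiting_homotopy S H' /\
      {within unitI `*` unitI `*` unitI, continuous Phi} /\
      (forall t s, unitI t -> unitI s ->
        Phi (t, s, 0) = H (t, s) /\ Phi (t, s, 1) = H' (t, s)) /\
      (forall s a, unitI s -> unitI a ->
        exit_path S (fun t => Phi (t, s, a)) /\
        Phi (0, s, a) = H (0, s) /\ Phi (1, s, a) = H (1, s)).
Proof.
move=> [cH _ He Hexit].
have in0 : unitI (0 : R) by rewrite unitIE lexx ler01.
have in1 : unitI (1 : R) by rewrite unitIE lexx ler01.
have clI (t : R) : unitI t -> clamp 0 1 t = t by rewrite unitIE; exact: clamp_id.
have [F [cF imm [_ F01 Fe Fexit]]] := exit_path_push (Hexit 0 in0).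
have cpF : continuous (pi \o F).
  by move=> z; apply: continuous_comp; [exact: cF | exact: orbit_pi_continuous].
pose contract (z : R * R * R) := H (clamp 0 1 z.1.1, clamp 0 1 ((1 - 2 * z.2) * z.1.2)).
pose push (z : R * R * R) := (pi \o F) (clamp 0 1 z.1.1, 2 * z.2 - 1).
pose Phi z := if z.2 <= 2^-1 then contract z else push z.
have c11 (z : R * R * R) : {for z, continuous (fun z : R * R * R => clamp 0 1 z.1.1)}.
  apply: (@continuous_comp _ _ _ (fun z : R * R * R => z.1.1) (clamp 0 1));
    last exact: clamp_continuous.
  by apply: (@continuous_comp _ _ _ fst fst); exact: cvg_fst.
have c12 (z : R * R * R) : {for z, continuous (fun z : R * R * R => z.1.2)}.
  by apply: (@continuous_comp _ _ _ fst snd); [exact: cvg_fst | exact: cvg_snd].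
have c2 (z : R * R * R) : {for z, continuous (fun z : R * R * R => 2 * z.2)}.
  by apply: cvgM; [exact: cvg_cst | exact: cvg_snd].
have cPhi : continuous Phi.
  apply: (@glue_continuous R _ _ snd 2^-1 contract push).
  - by move=> z; exact: cvg_snd.
  - apply: (@within_continuous_comp _ _ _ (unitI `*` unitI) H
      (fun z : R * R * R => (clamp 0 1 z.1.1, clamp 0 1 ((1 - 2 * z.2) * z.1.2))) cH).
      move=> z; apply: (@continuous_pair _ _ _ (fun z : R * R * R => clamp 0 1 z.1.1)
        (fun z : R * R * R => clamp 0 1 ((1 - 2 * z.2) * z.1.2))); first exact: c11.
      apply: (@continuous_comp _ _ _ (fun z : R * R * R => (1 - 2 * z.2) * z.1.2) (clamp 0 1));
        last exact: clamp_continuous.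
      apply: cvgM; last exact: c12.
      by apply: cvgB; [exact: cvg_cst | exact: c2].
    by move=> z; split; exact: unitI_clamp.
  - move=> z; apply: (@continuous_comp _ _ _
      (fun z : R * R * R => (clamp 0 1 z.1.1, 2 * z.2 - 1)) (pi \o F));
      last exact: cpF.
    apply: (@continuous_pair _ _ _ (fun z : R * R * R => clamp 0 1 z.1.1)
      (fun z : R * R * R => 2 * z.2 - 1)); first exact: c11.
    by apply: cvgB; [exact: c2 | exact: cvg_cst].
  - move=> [[t s] a] /= ->; rewrite /contract /push /=.
    rewrite divff // subrr mul0r (clI 0) //.
    by have [/= -> _] := F01 _ (unitI_clamp t).
exists (fun z => pi (F (z.1, 1))), Phi; split; last split; last split.
- split; last by move=> s _; exact: imm.
  split=> //; last by move=> s _; case: imm.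
  apply: continuous_subspaceT => z.
  apply: (@continuous_comp _ _ _ (fun z : R * R => (z.1, 1 : R)) (pi \o F)); last exact: cpF.
  by apply: continuous_pair; [exact: cvg_fst | exact: cvg_cst].
- exact: continuous_subspaceT.
- move=> t s tI sI; rewrite /Phi /=; split.
    by rewrite invr_ge0 ler0n /contract /= mulr0 subr0 mul1r !clI.
  have -> : (1 <= 2^-1 :> R) = false by apply/negbTE; rewrite -ltNge; lra.
  by rewrite /push /= clI //; congr (pi (F (_, _))); lra.
- move=> s a sI aI.
  have cPhi_a : {within unitI, continuous (fun t => Phi (t, s, a))}.
    apply: continuous_subspaceT => t.
    apply: (@continuous_comp _ _ _ (fun t : R => (t, s, a)) Phi); last exact: cPhi.
    apply: continuous_pair; last exact: cvg_cst.
    by apply: continuous_pair; [exact: cvg_id | exact: cvg_cst].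
  move: sI aI (sI) (aI); rewrite !unitIE => /andP[s0 s1] /andP[a0 a1] sI aI.
  have [ah|ah] := leP a 2^-1.
    have vI : unitI ((1 - 2 * a) * s).
      rewrite unitIE; apply/andP; split; first by apply: mulr_ge0; lra.
      by rewrite -[leRHS]mulr1; apply: ler_pM; lra.
    have PhiE t : unitI t -> Phi (t, s, a) = H (t, (1 - 2 * a) * s).
      by move=> tI; rewrite /Phi /= ah /contract /= !clI.
    have [_ mono] := Hexit _ vI.
    split; first by split=> // u t uI tI ut; rewrite !PhiE //; exact: mono.
    by rewrite !PhiE // (He _ vI).1 (He _ vI).2 (He s _).1 ?(He s _).2 // unitIE.
  have vI : unitI (2 * a - 1) by rewrite unitIE; apply/andP; split; lra.
  have PhiE t : unitI t -> Phi (t, s, a) = pi (F (t, 2 * a - 1)).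
    by move=> tI; rewrite /Phi /= leNgt ah /= /push /= clI.
  have [_ mono] := Fexit _ vI.
  split; first by split=> // u t uI tI ut; rewrite !PhiE //; exact: mono.
  have [e0 e1] := Fe _ vI; rewrite /= in e0 e1.
  by rewrite !PhiE // e0 e1 (He s _).1 ?(He s _).2 // unitIE.
Qed.

End ExitPathHomotopies.

Theorem lemma0p0p4 (R : realType) (n : nat) (M : manifold R n)
    (gT : finGroupType) (act : smooth_action M gT) :
  (* 1 *)
  (forall f : R -> orbit_space act, exit_path (orbit_strat act) f ->
    exists f' : R -> orbit_space act,
      immediately_exiting_path (orbit_strat act) f' /\
      exists F : R * R -> orbit_space act,
        exit_path_homotopy_between (orbit_strat act) f f' F) /\
  (* 2 *)
  (forall H : R * R -> orbit_space act, exit_path_homotopy (orbit_strat act) H ->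
    exists (H' : R * R -> orbit_space act) (Phi : R * R * R -> orbit_space act),
      immediately_exiting_homotopy (orbit_strat act) H' /\
      {within unitI `*` unitI `*` unitI, continuous Phi} /\
      (forall t s, unitI t -> unitI s ->
        Phi (t, s, 0) = H (t, s) /\ Phi (t, s, 1) = H' (t, s)) /\
      (forall s a, unitI s -> unitI a ->
        exit_path (orbit_strat act) (fun t => Phi (t, s, a)) /\
        Phi (0, s, a) = H (0, s) /\ Phi (1, s, a) = H (1, s))) /\
  (* 3 *)
  (forall K : R * R -> orbit_space act,
    immediately_exiting_homotopy (orbit_strat act) K ->
    forall y : M, orbit_pi act y = K (1, 0) ->
    exists L : R * R -> M, lift_along (orbit_pi act) K L /\ L (1, 0) = y) /\
  (forall f : R -> orbit_space act, exit_path (orbit_strat act) f ->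
    exists (f' : R -> orbit_space act) (F : R * R -> orbit_space act),
      immediately_exiting_path (orbit_strat act) f' /\
      exit_path_homotopy_between (orbit_strat act) f f' F /\
      forall y : M, orbit_pi act y = f 1 ->
      exists L : R * R -> M, lift_along (orbit_pi act) F L /\ L (1, 0) = y).
Proof.
split; last split; last split.
- move=> f /exit_path_push[F [cF imm hF]].
  by exists (fun t => orbit_pi act (F (t, 1))); split=> //; exists (orbit_pi act \o F).
- exact: exit_homotopy_contract.
- by move=> K [hK _] y; exact: exit_path_homotopy_lift.
- move=> f /exit_path_push[F [cF imm hF]].
  exists (fun t => orbit_pi act (F (t, 1))), (orbit_pi act \o F); split=> //; split=> // y.
  have in1 : unitI (1 : R) by rewrite unitIE lexx ler01.
  have [_ /(_ 1 in1)[/= <- _] _ _] := hF.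
  move=> /esym/orbit_piP[g gF]; exists (act g \o F); split=> //; split.
    apply: continuous_subspaceT => z.
    by apply: continuous_comp; [exact: cF | exact: smact_continuous].
  by move=> z _; rewrite /= orbit_pi_act.
Qed.
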